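(* Let $\Lambda$ be a left Artinian ring and let $G$ be a finite group acting on $\Lambda$. Assume $|G|$ is invertible in $\Lambda$. Then: (1) For each $k>0$, $\mathrm{TF}^k(\Lambda G)$ has finite representation type if and only if $\mathrm{TF}^k(\Lambda)$ has finite representation type. (2) The skew group ring $\Lambda G$ is CM-finite if and only if $\Lambda$ is CM-finite.
   Context: $G$ acts on $\Lambda$ by ring automorphisms. The skew group ring $\Lambda G$ is the free left $\Lambda$-module with basis $G$ and multiplication $(\lambda g)(\mu h)=\lambda\, g(\mu)\, gh$ for $\lambda,\mu\in\Lambda$, $g,h\in G$. Let $R$ be a ring; modules are left modules unless stated otherwise. For a finitely generated $R$-module $M$ and an exact sequence $P_1\xrightarrow{f}P_0\to M\to 0$ with $P_0,P_1$ finitely generated projective, $\operatorname{Tr}_R(M)=\operatorname{coker}(\operatorname{Hom}_R(f,R))$ (a right $R$-module, independent of choices up to projective summands). For $k>0$, $M$ is $k$-torsionfree if $\operatorname{Ext}^i_{R^{\mathrm{op}}}(\operatorname{Tr}_R(M),R)=0$ for all $1\le i\le k$. $\mathrm{TF}^k(R)$ is the full subcategory of the category of finitely generated left $R$-modules consisting of the $k$-torsionfree modules. A full subcategory of finitely generated modules has finite representation type if it contains only finitely many isomorphism classes of indecomposable modules. An $R$-module is Gorenstein projective if it is the image of a differential of an acyclic complex $\mathbf P$ of projective $R$-modules such that $\operatorname{Hom}_R(\mathbf P,Q)$ is acyclic for every projective $R$-module $Q$. $R$ is CM-finite if the category of finitely generated Gorenstein projective left $R$-modules has finite representation type. *)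

(* Defs.v *)
From HB Require Import structures.
From mathcomp Require Import all_boot all_order all_algebra all_fingroup.
From mathcomp Require Import boolp classical_sets.
Set Implicit Arguments.
Unset Strict Implicit.
Unset Printing Implicit Defensive.
Import GRing.Theory.
Local Open Scope ring_scope.

(* Rings are unital and possibly zero ([pzRingType]).  Left R-modules are
   [lmodType R], right R-modules are [lmodType R^c]; R as a right module over
   itself is [(R^c)^o]. *)

Record ring_action (L : pzRingType) (G : finGroupType) := RingAction {
  ract :> G -> {rmorphism L -> L};
  ract1 : forall x, ract 1%g x = x;
  ractM : forall g h x, ract (g * h)%g x = ract g (ract h x)
}.

(* The function x stands for the formal sum of the x(g) g.  This is an alias
   of [{ffun G -> L}] because the latter carries the pointwise product. *)
Definition skew_ring (L : pzRingType) (G : finGroupType) (a : ring_action L G) :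
  Type := {ffun G -> L}.

Section SkewGroupRing.
Variables (L : pzRingType) (G : finGroupType) (a : ring_action L G).

HB.instance Definition _ := GRing.Zmodule.copy (skew_ring a) {ffun G -> L}.

Definition skew_single (l : L) (g : G) : skew_ring a :=
  [ffun h => if h == g then l else 0].

Definition skew_one : skew_ring a := skew_single 1 1%g.

(* The coefficient at k of the product of x and y collects the terms
   x(g) g(y(h)) with g h = k. *)
Definition skew_mul (x y : skew_ring a) : skew_ring a :=
  [ffun k => \sum_(g : G) x g * a g (y (g^-1 * k)%g)].

Lemma skew_mulA : associative skew_mul.
Proof.
move=> x y z; apply/ffunP=> k; rewrite !ffunE.
under eq_bigr => g _ do rewrite ffunE rmorph_sum mulr_sumr.
under [RHS]eq_bigr => g _ do rewrite ffunE mulr_suml.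
rewrite [RHS]exchange_big /=; apply: eq_bigr => g _.
rewrite [RHS](reindex_inj (mulgI g)) /=; apply: eq_bigr => h _.
by rewrite rmorphM mulrA ractM mulKg invMg mulgA.
Qed.

Lemma skew_mul1l : left_id skew_one skew_mul.
Proof.
move=> x; apply/ffunP=> k; rewrite ffunE (bigD1 1%g) //= big1 => [|g gN1].
  by rewrite ffunE eqxx mul1r ract1 invg1 mul1g addr0.
by rewrite ffunE (negPf gN1) mul0r.
Qed.

Lemma skew_mul1r : right_id skew_one skew_mul.
Proof.
move=> x; apply/ffunP=> k; rewrite ffunE (bigD1 k) //= big1 => [|g gNk].
  by rewrite ffunE mulVg eqxx rmorph1 mulr1 addr0.
by rewrite ffunE -eq_mulVg1 (negPf gNk) rmorph0 mulr0.
Qed.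

Lemma skew_mulDl : left_distributive skew_mul +%R.
Proof.
move=> x y z; apply/ffunP=> k; rewrite !ffunE -big_split /=.
by apply: eq_bigr => g _; rewrite ffunE mulrDl.
Qed.

Lemma skew_mulDr : right_distributive skew_mul +%R.
Proof.
move=> x y z; apply/ffunP=> k; rewrite !ffunE -big_split /=.
by apply: eq_bigr => g _; rewrite ffunE rmorphD mulrDr.
Qed.

HB.instance Definition _ := GRing.Zmodule_isPzRing.Build (skew_ring a)
  skew_mulA skew_mul1l skew_mul1r skew_mulDl skew_mulDr.

Lemma skew_singleM (l m : L) (g h : G) :
  skew_single l g * skew_single m h = skew_single (l * a g m) (g * h)%g.
Proof.
apply/ffunP=> k; rewrite !ffunE (bigD1 g) //= big1 => [|g' gN].
  rewrite !ffunE eqxx addr0 (can2_eq (mulKVg g) (mulKg g)).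
  by case: eqP => _ //; rewrite rmorph0 mulr0.
by rewrite ffunE (negPf gN) mul0r.
Qed.

End SkewGroupRing.

Section Rings.
Variable R : pzRingType.

Definition invertible (x : R) := exists y, y * x = 1 /\ x * y = 1.

Definition left_ideal (I : set R) :=
  [/\ I 0, forall x y, I x -> I y -> I (x + y) & forall r x, I x -> I (r * x)].

Definition left_artinian :=
  forall I : nat -> set R, (forall n, left_ideal (I n)) ->
    (forall n, (I n.+1 `<=` I n)%classic) ->
  exists N, forall n, (N <= n)%N -> I n = I N.

End Rings.

Section Modules.
Variable R : pzRingType.
Implicit Types M N P Q A B C : lmodType R.

Definition surj (T U : Type) (f : T -> U) := forall y, exists x, f x = y.

(* exactness of A -> B -> C at B *)
Definition exact_at (T U : Type) (V : zmodType) (f : T -> U) (g : U -> V) :=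
  forall y, g y = 0 <-> exists x, f x = y.

(* exactness of Hom(C,Q) -> Hom(B,Q) -> Hom(A,Q) at Hom(B,Q) *)
Definition hom_exact_at A B C Q (f : {linear A -> B}) (g : {linear B -> C}) :=
  forall u : {linear B -> Q},
    (forall x, u (f x) = 0) <->
    (exists v : {linear C -> Q}, forall y, v (g y) = u y).

Definition isomorphic M N := exists f : {linear M -> N}, bijective f.

Definition fin_gen M :=
  exists n (e : 'I_n -> M), forall x, exists c : 'I_n -> R,
    x = \sum_(i < n) c i *: e i.

Definition projective P :=
  forall A B (p : {linear A -> B}) (f : {linear P -> B}), surj p ->
  exists h : {linear P -> A}, forall x, p (h x) = f x.

Definition zero_module M := forall x : M, x = 0.

Definition indecomposable M :=
  ~ zero_module M /\
  forall A B, isomorphic M (A * B)%type -> zero_module A \/ zero_module B.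

Definition finite_rep_type (C : lmodType R -> Prop) :=
  exists n (X : 'I_n -> lmodType R),
    forall M, C M -> indecomposable M -> exists i, isomorphic M (X i).

Record projective_resolution (M : lmodType R) := ProjectiveResolution {
  pr_obj : nat -> lmodType R;
  pr_d : forall n, {linear pr_obj n.+1 -> pr_obj n};
  pr_aug : {linear pr_obj 0%N -> M};
  pr_proj : forall n, projective (pr_obj n);
  pr_aug_surj : surj pr_aug;
  pr_exact0 : exact_at (pr_d 0%N) pr_aug;
  pr_exactS : forall n, exact_at (pr_d n.+1) (pr_d n)
}.

(* Ext^i(M, Q) = 0: the complex Hom(P_*, Q) is exact in degree i, for a
   projective resolution P_* of M. *)
Definition ext_zero i M Q :=
  exists P : projective_resolution M,
    if i is n.+1 then hom_exact_at Q (pr_d P n.+1) (pr_d P n)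
    else forall u : {linear pr_obj P 0%N -> Q},
           (forall x, u (pr_d P 0%N x) = 0) -> forall x, u x = 0.

(* M is the image of a differential of a complex P with
   d i : P (i + 1) -> P i. *)
Definition gorenstein_projective M :=
  exists (P : int -> lmodType R) (d : forall i, {linear P (i + 1) -> P i}),
    [/\ forall i, projective (P i),
        forall i, exact_at (d (i + 1)) (d i),
        forall Q, projective Q -> forall i, hom_exact_at Q (d (i + 1)) (d i) &
        exists i (j : {linear M -> P i}), injective j /\
          forall y, (exists x, j x = y) <-> (exists x, d i x = y)].

Definition CM_finite :=
  finite_rep_type (fun M => fin_gen M /\ gorenstein_projective M).

End Modules.

Section Dual.
Variables (R : pzRingType) (P : lmodType R).

(* Hom_R(P, R), a right R-module through the right action of R on the values *)
Definition dual : Type := {linear P -> R^o}.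

Identity Coercion linear_of_dual : dual >-> GRing.Linear.type.

Lemma dualP (u v : dual) : u =1 v -> u = v.
Proof.
case: u v => [u [[cu] [su]]] [v [[cv] [sv]]] /= /funext uv.
case: _ / uv cv sv => cv sv.
by rewrite (Prop_irrelevance cu cv) (Prop_irrelevance su sv).
Qed.

Definition mk_dual (f : P -> R^o) (lf : linear f) : dual :=
  HB.pack f (GRing.isLinear.Build R P R^o *:%R f lf).

Lemma dual_zero_subproof : linear (fun _ : P => 0 : R^o).
Proof. by move=> r x y; rewrite scaler0 addr0. Qed.

Lemma dual_opp_subproof (u : dual) : linear (fun x => - u x : R^o).
Proof. by move=> r x y; rewrite linearP opprD scalerN. Qed.

Lemma dual_add_subproof (u v : dual) : linear (fun x => u x + v x : R^o).
Proof. by move=> r x y; rewrite !linearP scalerDr addrACA. Qed.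

Lemma dual_scale_subproof (r : R) (u : dual) :
  linear (fun x => (u x : R) * r : R^o).
Proof. by move=> s x y; rewrite linearP mulrDl -[in LHS]mulrA. Qed.

Definition dual_zero := mk_dual dual_zero_subproof.
Definition dual_opp u := mk_dual (dual_opp_subproof u).
Definition dual_add u v := mk_dual (dual_add_subproof u v).
Definition dual_scale (r : R^c) u := mk_dual (dual_scale_subproof r u).

Lemma dual_addA : associative dual_add.
Proof. by move=> u v w; apply: dualP => x /=; rewrite addrA. Qed.

Lemma dual_addC : commutative dual_add.
Proof. by move=> u v; apply: dualP => x /=; rewrite addrC. Qed.

Lemma dual_add0 : left_id dual_zero dual_add.
Proof. by move=> u; apply: dualP => x /=; rewrite add0r. Qed.

Lemma dual_addN : left_inverse dual_zero dual_opp dual_add.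
Proof. by move=> u; apply: dualP => x /=; rewrite addNr. Qed.

HB.instance Definition _ := gen_eqMixin dual.
HB.instance Definition _ := gen_choiceMixin dual.
HB.instance Definition _ :=
  GRing.isZmodule.Build dual dual_addA dual_addC dual_add0 dual_addN.

Lemma dual_scaleA (r s : R^c) u :
  dual_scale r (dual_scale s u) = dual_scale (r * s) u.
Proof. by apply: dualP => x /=; rewrite -mulrA. Qed.

Lemma dual_scale1 : left_id 1 dual_scale.
Proof. by move=> u; apply: dualP => x /=; rewrite mulr1. Qed.

Lemma dual_scaleDr : right_distributive dual_scale +%R.
Proof. by move=> r u v; apply: dualP => x /=; rewrite mulrDl. Qed.

Lemma dual_scaleDl u : {morph dual_scale^~ u : r s / r + s}.
Proof. by move=> r s; apply: dualP => x /=; rewrite mulrDr. Qed.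

HB.instance Definition _ := GRing.Zmodule_isLmodule.Build R^c dual
  dual_scaleA dual_scale1 dual_scaleDr dual_scaleDl.

End Dual.

Section Transpose.
Variable R : pzRingType.

Definition dual_map (P Q : lmodType R) (f : {linear P -> Q}) (u : dual Q) :
  dual P := (u : {linear Q -> R^o}) \o f.

Lemma dual_map_is_linear (P Q : lmodType R) (f : {linear P -> Q}) :
  linear (dual_map f : dual Q -> dual P).
Proof. by move=> r u v; apply: dualP. Qed.

HB.instance Definition _ (P Q : lmodType R) (f : {linear P -> Q}) :=
  GRing.isLinear.Build R^c (dual Q) (dual P) *:%R (dual_map f)
    (dual_map_is_linear f).

(* N is a value of Tr M, i.e. N is a cokernel of Hom(f, R) for some finitely
   generated projective presentation f of M. *)
Definition is_transpose (M : lmodType R) (N : lmodType R^c) :=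
  exists (P1 P0 : lmodType R) (f : {linear P1 -> P0}) (p : {linear P0 -> M})
         (q : {linear dual P1 -> N}),
    [/\ fin_gen P1 /\ projective P1, fin_gen P0 /\ projective P0,
        exact_at f p /\ surj p & exact_at (dual_map f) q /\ surj q].

Definition torsionfree (k : nat) (M : lmodType R) :=
  exists N : lmodType R^c, is_transpose M N /\
    forall i, (1 <= i <= k)%N -> ext_zero i N (R^c)^o.

Definition TF (k : nat) (M : lmodType R) := fin_gen M /\ torsionfree k M.

End Transpose.

(* Main.v *)
From HB Require Import structures.
From mathcomp Require Import all_boot all_algebra all_fingroup.
From mathcomp Require Import boolp classical_sets.
Require Import Defs.

(** Induction and restriction along a split and separable Frobenius extension
    are adjoint to each other on both sides, and every module is a direct
    summand of what one obtains by applying both.  That is all that is used of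
    the skew group ring [B] of [G] over [A]: [B] is a Frobenius extension of
    [A] by the coefficient at the unit of [G], it is split because this
    coefficient of 1 is 1, and separable because the order of [G] is
    invertible.  The axioms of a Frobenius extension are symmetric under
    passage to the opposite rings, and so the same constructions apply to the
    right modules in which transposes live.

    Let [CA] and [CB] be classes of finitely generated modules that are closed
    under direct summands and correspond to each other under induction and
    restriction.  An indecomposable [N] in [CB] is a summand of the module
    induced from its restriction, hence, by the Krull-Schmidt property, of a
    module induced from an indecomposable summand of the restriction.  If the
    latter run through finitely many classes, then so does [N], because each
    induced module has only finitely many indecomposable summands.  The
    converse is the same argument with the two rings exchanged
    ([finite_rep_type_transfer], [frobenius_finite_rep_type]).

    The Krull-Schmidt property over a left Artinian ring rests on Fitting's
    lemma.  It is derived from the descending chain condition alone: Fitting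
    decompositions exist for endomorphisms of Artinian projective modules
    ([projective_fitting]), and they descend along a surjection from a free
    module of finite rank to any finitely generated module ([fitting]).

    For torsionfree modules, the vanishing of Ext passes to direct summands up
    to projectives ([stable_retract_ext_zero]), and a direct summand [X] of
    [M] has a transpose that is such a summand of a given transpose of [M]
    ([transpose_retract]).  Both induction and restriction are exact, preserve
    projectives, commute with the dual Hom(-, R), and respect the extension
    of maps to the ring along syzygies; hence they commute with transposes
    ([coind_transpose], [res_transpose]) and preserve the vanishing of Ext.

    For Gorenstein projective modules, totally acyclic complexes are replaced
    by their syzygies: a module is Gorenstein projective as soon as it lies in
    some class that can be continued by [acyclic_step] in both directions
    ([gorenstein_projective_coind]).  Induction and restriction preserve such
    steps.  For a direct summand [X] of a Gorenstein projective module with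
    complement [Y], the cosyzygies of [X] are extensions of a Gorenstein
    projective module by [Y]; so one takes as the class the closure under
    extensions of all such summands ([gorenstein_projective_retract]). *)

Set Implicit Arguments.
Unset Strict Implicit.
Unset Printing Implicit Defensive.
Import GRing.Theory.
Local Open Scope ring_scope.

(** * Submodules, quotients and factorisation of linear maps *)

Definition mk_linear (R : pzRingType) (A B : lmodType R) (f : A -> B)
    (lf : linear f) : {linear A -> B} :=
  HB.pack f (GRing.isLinear.Build R A B *:%R f lf).

Definition submod (R : pzRingType) (M : lmodType R) (N : set M) :=
  [/\ N 0, forall x y, N x -> N y -> N (x + y) & forall r x, N x -> N (r *: x)].

Section Submod.
Variables (R : pzRingType) (M : lmodType R) (N : set M) (sN : submod N).

Lemma submodN x : N x -> N (- x).
Proof. by case: sN => _ _ NZ Nx; rewrite -scaleN1r; apply: NZ. Qed.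

Lemma submodB x y : N x -> N y -> N (x - y).
Proof. by case: (sN) => _ ND _ Nx Ny; apply/ND/submodN. Qed.

Definition subm : Type := {x : M | N x}.

Lemma subm_eq (u v : subm) : sval u = sval v -> u = v.
Proof.
case: u v => [x Nx] [y Ny] /= xy; case: _ / xy Ny => Ny.
by rewrite (Prop_irrelevance Nx Ny).
Qed.

Let subm0 : subm := exist _ 0 (let: And3 N0 _ _ := sN in N0).
Let submD (u v : subm) : subm :=
  exist _ _ (let: And3 _ ND _ := sN in ND _ _ (svalP u) (svalP v)).
Let submO (u : subm) : subm := exist _ _ (submodN (svalP u)).
Let submZ r (u : subm) : subm :=
  exist _ _ (let: And3 _ _ NZ := sN in NZ r _ (svalP u)).

Let submA : associative submD.
Proof. by move=> u v w; apply: subm_eq; apply: addrA. Qed.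
Let submC : commutative submD.
Proof. by move=> u v; apply: subm_eq; apply: addrC. Qed.
Let subm0D : left_id subm0 submD.
Proof. by move=> u; apply: subm_eq; apply: add0r. Qed.
Let submND : left_inverse subm0 submO submD.
Proof. by move=> u; apply: subm_eq; apply: addNr. Qed.

HB.instance Definition _ := gen_eqMixin subm.
HB.instance Definition _ := gen_choiceMixin subm.
HB.instance Definition _ := GRing.isZmodule.Build subm submA submC subm0D submND.

Let submZA r s u : submZ r (submZ s u) = submZ (r * s) u.
Proof. by apply: subm_eq; apply: scalerA. Qed.
Let subm1Z : left_id 1 submZ.
Proof. by move=> u; apply: subm_eq; apply: scale1r. Qed.
Let submZDr : right_distributive submZ +%R.
Proof. by move=> r u v; apply: subm_eq; apply: scalerDr. Qed.
Let submZDl u : {morph submZ^~ u : r s / r + s}.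
Proof. by move=> r s; apply: subm_eq; apply: scalerDl. Qed.

HB.instance Definition _ :=
  GRing.Zmodule_isLmodule.Build R subm submZA subm1Z submZDr submZDl.

Lemma submodule_exists : exists (S : lmodType R) (i : {linear S -> M}),
  injective i /\ forall x, N x <-> exists u, i u = x.
Proof.
have lv : linear (sval : subm -> M) by [].
exists subm, (mk_linear lv); split=> [u v /subm_eq //|x].
by split=> [Nx|[[y Ny] /= <-]//]; exists (exist _ x Nx).
Qed.

Let rep (x : M) : M := xget 0 [set y | N (y - x)]%classic.

Let repP x : N (rep x - x).
Proof.
rewrite /rep; case: xgetP => [y _ //|/(_ x)] /=.
by rewrite subrr; case: sN => N0 _ _ /(_ N0).
Qed.

Let rep_eq x y : N (x - y) -> rep x = rep y.
Proof.
move=> Nxy; congr (xget 0 _); apply/predeqP => z /=.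
case: (sN) => _ ND _; split=> Nz.
  by rewrite -(subrKA x); apply: ND.
by rewrite -(subrKA y); apply: ND => //; rewrite -opprB; apply: submodN.
Qed.

Let rep_eqP x y : rep x = rep y -> N (x - y).
Proof.
move=> xy; have := submodB (repP y) (repP x).
by rewrite xy opprB addrC subrKA.
Qed.

Let repK x : rep (rep x) = rep x.
Proof. exact/rep_eq/repP. Qed.

Definition quom : Type := {x : M | rep x = x}.

Let pr (x : M) : quom := exist _ (rep x) (repK x).

Let quom_eq (u v : quom) : sval u = sval v -> u = v.
Proof.
case: u v => [x Nx] [y Ny] /= xy; case: _ / xy Ny => Ny.
by rewrite (Prop_irrelevance Nx Ny).
Qed.

Let pr_sval u : pr (sval u) = u.
Proof. by apply: quom_eq; case: u. Qed.

Let pr_eq x y : N (x - y) -> pr x = pr y.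
Proof. by move=> xy; apply: quom_eq; exact: rep_eq xy. Qed.

Let quomD (u v : quom) : quom := pr (sval u + sval v).
Let quomO (u : quom) : quom := pr (- sval u).
Let quomZ r (u : quom) : quom := pr (r *: sval u).

Let prD x y : quomD (pr x) (pr y) = pr (x + y).
Proof.
apply: pr_eq; rewrite /= opprD addrACA.
by case: (sN) => _ ND _; apply: ND; apply: repP.
Qed.
Let prO x : quomO (pr x) = pr (- x).
Proof. by apply: pr_eq; rewrite -opprD; apply/submodN/repP. Qed.
Let prZ r x : quomZ r (pr x) = pr (r *: x).
Proof.
by apply: pr_eq; rewrite -scalerBr; case: (sN) => _ _; apply; apply: repP.
Qed.

Let quomA : associative quomD.
Proof.
move=> u v w; rewrite -[u]pr_sval -[v]pr_sval -[w]pr_sval.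
by rewrite !prD addrA.
Qed.
Let quomC : commutative quomD.
Proof. by move=> u v; rewrite /quomD addrC. Qed.
Let quom0D : left_id (pr 0) quomD.
Proof. by move=> u; rewrite -[u]pr_sval prD add0r. Qed.
Let quomND : left_inverse (pr 0) quomO quomD.
Proof. by move=> u; rewrite -[u]pr_sval prO prD addNr. Qed.

HB.instance Definition _ := gen_eqMixin quom.
HB.instance Definition _ := gen_choiceMixin quom.
HB.instance Definition _ := GRing.isZmodule.Build quom quomA quomC quom0D quomND.

Let quomZA r s u : quomZ r (quomZ s u) = quomZ (r * s) u.
Proof. by rewrite -[u]pr_sval !prZ scalerA. Qed.
Let quom1Z : left_id 1 quomZ.
Proof. by move=> u; rewrite -[u]pr_sval prZ scale1r. Qed.
Let quomZDr : right_distributive quomZ +%R.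
Proof.
move=> r u v; rewrite -[u]pr_sval -[v]pr_sval prZ prZ.
by rewrite [pr _ + _]prD [RHS]prD prZ scalerDr.
Qed.
Let quomZDl u : {morph quomZ^~ u : r s / r + s}.
Proof. by move=> r s; rewrite -[u]pr_sval !prZ [RHS]prD scalerDl. Qed.

HB.instance Definition _ :=
  GRing.Zmodule_isLmodule.Build R quom quomZA quom1Z quomZDr quomZDl.

Lemma quotient_exists : exists (C : lmodType R) (c : {linear M -> C}),
  surj c /\ forall x, c x = 0 <-> N x.
Proof.
have lp : linear (pr : M -> quom).
  by move=> r x y; rewrite -[r *: pr x]/(quomZ r (pr x)) prZ [RHS]prD.
exists quom, (mk_linear lp); split=> [u|x]; first by exists (sval u); apply: pr_sval.
split=> [|Nx]; last by apply: pr_eq; rewrite subr0.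
by move/(congr1 sval)/rep_eqP; rewrite subr0.
Qed.

End Submod.

Section Linear.
Variable R : pzRingType.
Implicit Types A B C D M P Q : lmodType R.

Lemma linear_inj A B (f : {linear A -> B}) :
  (forall x, f x = 0 -> x = 0) -> injective f.
Proof.
move=> f0 x y /eqP; rewrite -subr_eq0 -linearB => /eqP /f0 /eqP.
by rewrite subr_eq0 => /eqP.
Qed.

Lemma inj_eq0 A B (f : {linear A -> B}) x : injective f -> f x = 0 -> x = 0.
Proof. by move=> fI fx; apply: fI; rewrite fx linear0. Qed.

Lemma submod_im A B (f : {linear A -> B}) : submod [set y | exists x, f x = y]%classic.
Proof.
split=> [|x y [u <-] [v <-]|r x [u <-]]; first by exists 0; rewrite linear0.
  by exists (u + v); rewrite linearD.
by exists (r *: u); rewrite linearZ.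
Qed.

Lemma submod_ker A B (f : {linear A -> B}) : submod [set x | f x = 0]%classic.
Proof.
split=> [|x y /= fx fy|r x /= fx]; first exact: linear0.
  by rewrite linearD fx fy addr0.
by rewrite linearZZ fx scaler0.
Qed.

Lemma factor_surj A B C (p : {linear A -> B}) (f : {linear A -> C}) :
  surj p -> (forall x, p x = 0 -> f x = 0) ->
  exists h : {linear B -> C}, forall x, h (p x) = f x.
Proof.
move=> /choice[s sK] pf.
have hE x y : p x = p y -> f x = f y.
  move=> /eqP; rewrite -subr_eq0 -linearB => /eqP /pf /eqP.
  by rewrite linearB subr_eq0 => /eqP.
have lh : linear (fun y => f (s y)).
  by move=> r x y; rewrite -linearP; apply: hE; rewrite linearP !sK.
by exists (mk_linear lh) => x; apply: hE; rewrite sK.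
Qed.

Lemma factor_inj A B C (i : {linear B -> C}) (f : {linear A -> C}) :
  injective i -> (forall x, exists y, i y = f x) ->
  exists h : {linear A -> B}, forall x, i (h x) = f x.
Proof.
move=> iI /choice[h hE].
have lh : linear h by move=> r x y; apply: iI; rewrite linearP !hE linearP.
by exists (mk_linear lh).
Qed.

Lemma proj_lift P A C (g : {linear A -> C}) (h : {linear P -> C}) :
  projective P -> (forall y, exists x, g x = h y) ->
  exists l : {linear P -> A}, forall y, g (l y) = h y.
Proof.
move=> prP gh; have [S [i [iI imi]]] := submodule_exists (submod_im g).
have [|g' g'E] := @factor_inj _ _ _ i g iI.
  by move=> x; apply/imi; exists x.
have [|h' h'E] := @factor_inj _ _ _ i h iI.
  by move=> y; apply/imi/gh.
have g's : surj g'.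
  move=> y; have /imi[x xE] : exists u, i u = i y by exists y.
  by exists x; apply: iI; rewrite g'E.
by have [l lE] := prP _ _ g' h' g's; exists l => y; rewrite -g'E lE.
Qed.

Lemma pair_addE A B (x z : A) (y w : B) : (x, y) + (z, w) = (x + z, y + w).
Proof. by []. Qed.

Lemma pair_map_linear A B C (f : {linear C -> A}) (g : {linear C -> B}) :
  linear (fun x => (f x, g x)).
Proof. by move=> r x y; rewrite !linearP. Qed.

Definition pair_map A B C (f : {linear C -> A}) (g : {linear C -> B}) :
  {linear C -> (A * B)%type} := mk_linear (pair_map_linear f g).

Lemma copair_map_linear A B C (f : {linear A -> C}) (g : {linear B -> C}) :
  linear (fun x : A * B => f x.1 + g x.2).
Proof. by move=> r x y; rewrite !linearP scalerDr addrACA. Qed.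

Definition copair_map A B C (f : {linear A -> C}) (g : {linear B -> C}) :
  {linear (A * B)%type -> C} := mk_linear (copair_map_linear f g).

Lemma proj_prod P Q : projective P -> projective Q -> projective (P * Q)%type.
Proof.
move=> prP prQ A B p f ps.
have [h1 h1E] := prP A B p (f \o pair_map idfun \0) ps.
have [h2 h2E] := prQ A B p (f \o pair_map \0 idfun) ps.
exists (copair_map h1 h2) => -[x y] /=.
rewrite linearD h1E h2E /= -linearD; congr (f _).
by rewrite pair_addE addr0 add0r.
Qed.

End Linear.

(** * Finitely generated modules and the descending chain condition *)

Section FinGen.
Variable R : pzRingType.
Implicit Types A B C M P Q : lmodType R.

Lemma fin_genP (I : finType) M (e : I -> M) :
  (forall x, exists c : I -> R, x = \sum_i c i *: e i) -> fin_gen M.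
Proof.
move=> eM; exists #|I|, (e \o enum_val) => x.
have [c ->] := eM x; exists (c \o enum_val).
by rewrite (reindex (enum_val (A := I))) //; apply/onW_bij/enum_val_bij.
Qed.

Lemma fin_gen_surj M A (p : {linear M -> A}) : surj p -> fin_gen M -> fin_gen A.
Proof.
move=> ps [n [e eM]]; exists n, (p \o e) => y.
have [x <-] := ps y; have [c ->] := eM x; exists c.
by rewrite linear_sum; apply: eq_bigr => i _; rewrite linearZZ.
Qed.

Lemma fin_gen_prod A B : fin_gen A -> fin_gen B -> fin_gen (A * B)%type.
Proof.
move=> [n [e eA]] [m [f fB]].
pose g (i : 'I_n + 'I_m) : (A * B)%type :=
  match i with inl j => (e j, 0) | inr j => (0, f j) end.
apply: (@fin_genP _ _ g) => -[x y]; have [c xE] := eA x; have [d yE] := fB y.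
exists (fun i => match i with inl j => c j | inr j => d j end).
rewrite big_sumType /=.
have -> : \sum_i c i *: (e i, 0 : B) = (x, 0).
  rewrite xE -[RHS]/(pair_map idfun \0 (\sum_i c i *: e i)) linear_sum.
  by apply: eq_bigr => i _; rewrite linearZZ.
have -> : \sum_i d i *: (0 : A, f i) = (0, y).
  rewrite yE -[RHS]/(pair_map \0 idfun (\sum_i d i *: f i)) linear_sum.
  by apply: eq_bigr => i _; rewrite linearZZ.
by rewrite pair_addE addr0 add0r.
Qed.

Lemma lincomb_linear n M (e : 'I_n -> M) :
  linear (fun c : {ffun 'I_n -> R^o} => \sum_i (c i : R) *: e i).
Proof.
move=> r x y; rewrite scaler_sumr -big_split /=.
by apply: eq_bigr => i _; rewrite !ffunE scalerDl scalerA.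
Qed.

Definition ffun_delta n (i : 'I_n) : {ffun 'I_n -> R^o} :=
  [ffun j => (j == i)%:R].

Lemma ffun_lincomb n (c : {ffun 'I_n -> R^o}) :
  c = \sum_i (c i : R) *: ffun_delta i.
Proof.
apply/ffunP => j; rewrite sum_ffunE (bigD1 j) //= big1 => [|i ij].
  by rewrite !ffunE eqxx addr0 /GRing.scale /= mulr1.
by rewrite !ffunE eq_sym (negPf ij) /GRing.scale /= mulr0.
Qed.

Lemma free_projective n : projective {ffun 'I_n -> R^o}.
Proof.
move=> A B p f /choice[s sK].
exists (mk_linear (lincomb_linear (fun i => s (f (ffun_delta i))))).
move=> x; rewrite [in RHS](ffun_lincomb x) !linear_sum /=.
by apply: eq_bigr => i _; rewrite !linearZZ sK.
Qed.

Lemma free_fin_gen n : fin_gen {ffun 'I_n -> R^o}.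
Proof. by exists n, (@ffun_delta n) => x; exists x; apply: ffun_lincomb. Qed.

Lemma free_cover M : fin_gen M -> exists P (p : {linear P -> M}),
  [/\ projective P, fin_gen P & surj p].
Proof.
move=> [n [e eM]]; exists {ffun 'I_n -> R^o}, (mk_linear (lincomb_linear e)).
split; [exact: free_projective | exact: free_fin_gen |].
move=> x; have [c ->] := eM x; exists [ffun i => c i] => /=.
by apply: eq_bigr => i _; rewrite ffunE.
Qed.

Definition dcc M := forall N : nat -> set M, (forall n, submod (N n)) ->
    (forall n, (N n.+1 `<=` N n)%classic) ->
  exists m, forall n, (m <= n)%N -> N n = N m.

Lemma decr_chain M (N : nat -> set M) : (forall n, (N n.+1 `<=` N n)%classic) ->
  forall m n, (m <= n)%N -> (N n `<=` N m)%classic.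
Proof.
move=> Nd m n /subnKC <-; elim: (n - m)%N => [|k IH]; first by rewrite addn0.
by rewrite addnS; apply: subset_trans IH.
Qed.

Lemma dcc_ext A B C (f : {linear A -> B}) (g : {linear B -> C}) :
  exact_at f g -> dcc A -> dcc C -> dcc B.
Proof.
move=> fg dA dC N sN Nd; have NdW := decr_chain Nd.
have [||ma maP] := dA (fun n => [set x | N n (f x)]%classic).
- move=> n; have [N0 ND NZ] := sN n.
  split=> [|x y|r x]; rewrite /= ?linear0 ?linearD ?linearZZ //.
    exact: ND.
  exact: NZ.
- by move=> n x; apply: Nd.
have [||mc mcP] := dC (fun n => [set y | exists2 x, N n x & g x = y]%classic).
- move=> n; have [N0 ND NZ] := sN n.
  split=> [|x y [u Nu <-] [v Nv <-]|r x [u Nu <-]].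
  + by exists 0; rewrite ?linear0.
  + by exists (u + v); rewrite ?linearD //; apply: ND.
  + by exists (r *: u); rewrite ?linearZ //; apply: NZ.
- by move=> n y [x /Nd Nx <-]; exists x.
exists (maxn ma mc) => n; rewrite geq_max => /andP[man mcn].
have Nn := NdW (maxn ma mc) n; rewrite geq_max man mcn in Nn.
apply/seteqP; split; first exact: Nn.
move=> x Nx.
have : [set y | exists2 x, N n x & g x = y]%classic (g x).
  rewrite (mcP n mcn) -(mcP (maxn ma mc)) ?leq_maxr //.
  by exists x.
move=> [y Ny gy]; have /fg[a aE] : g (y - x) = 0 by rewrite linearB gy subrr.
have : [set x | N n (f x)]%classic a.
  rewrite (maP n man) -(maP (maxn ma mc)) ?leq_maxl //= aE.
  by apply: (submodB (sN _)) => //; apply: Nn.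
by rewrite /= aE => Nyx; have := submodB (sN n) Ny Nyx; rewrite opprB subrKC.
Qed.

Lemma dcc_fin_gen M : left_artinian R -> fin_gen M -> dcc M.
Proof.
move=> hR [n [e eM]]; elim: n => [|n IH] in M e eM *.
  have M0 (x : M) : x = 0 by have [c ->] := eM x; rewrite big_ord0.
  move=> N sN _; exists 0%N => m _; apply/seteqP.
  by split=> x _; rewrite (M0 x); case: (sN m); case: (sN 0%N).
have lf : linear (fun r : R^o => (r : R) *: e ord0).
  by move=> r x y; rewrite scalerDl scalerA.
have [C [c [cs cE]]] := quotient_exists (submod_im (mk_linear lf)).
apply: (@dcc_ext R^o M C (mk_linear lf) c); [exact: cE | exact: hR |].
apply: (IH _ (fun i => c (e (lift ord0 i)))) => y; have [x <-] := cs y.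
have [d ->] := eM x; exists (fun i => d (lift ord0 i)).
rewrite big_ord_recl linearD linear_sum [X in X + _](_ : _ = 0) ?add0r.
  by apply: eq_bigr => i _; rewrite linearZZ.
by apply/cE; exists (d ord0).
Qed.

Lemma dcc_min M (Pr : set M -> Prop) : dcc M ->
  (exists N, submod N /\ Pr N) ->
  exists N, [/\ submod N, Pr N &
    forall N', submod N' -> Pr N' -> (N' `<=` N)%classic -> N' = N].
Proof.
move=> dM [N0 PN0]; apply: contrapT => noMin.
pose T := {N | submod N /\ Pr N}.
have /choice[next nextP] (u : T) : exists v : T,
    (sval v `<=` sval u)%classic /\ sval v <> sval u.
  case: u => [N [sN PN]] /=; apply: contrapT => nov; apply: noMin.
  exists N; split=> // N' sN' PN' N'N; apply: contrapT => neq; apply: nov.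
  by exists (exist _ N' (conj sN' PN')).
pose u n : T := iter n next (exist _ N0 PN0).
have [||m mP] := dM (fun n => sval (u n)).
- by move=> n; case: (svalP (u n)).
- by move=> n; case: (nextP (u n)).
by case: (nextP (u m)) => _; apply; apply: (mP m.+1).
Qed.

End FinGen.

(** * Fitting decompositions *)

Section Fitting.
Variable R : pzRingType.
Implicit Types A B C M P Q : lmodType R.

Lemma iter_is_linear M (f : {linear M -> M}) n : linear (iter n f).
Proof. by elim: n => [|n IH] r x y //=; rewrite IH linearP. Qed.

Definition lin_iter M (f : {linear M -> M}) n : {linear M -> M} :=
  mk_linear (iter_is_linear f n).

Lemma iter_range_stable M (f : {linear M -> M}) : dcc M ->
  exists n, forall x, exists y, iter n.+1 f x = iter (n.+1 + n.+1) f y.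
Proof.
move=> dM.
have [||m mP] := dM (fun n => [set y | exists x, lin_iter f n x = y]%classic).
- by move=> n; apply: submod_im.
- by move=> n y [x <-]; exists (f x) => /=; rewrite -iterSr.
exists m => x.
have : [set y | exists x, lin_iter f m.+1 x = y]%classic (iter m.+1 f x).
  by exists x.
rewrite mP // -(mP (m.+1 + m.+1)%N) => [[y yE]|]; first by exists y.
by rewrite addSn leqW // leq_addr.
Qed.

(** The images of [Q] under the powers of [t] form a descending chain, and
    where it becomes stationary, injectivity cancels the power. *)
Lemma injective_on_surjective M (t : {linear M -> M}) (Q : set M) :
  dcc M -> submod Q -> (forall x, Q x -> Q (t x)) ->
  (forall x, Q x -> t x = 0 -> x = 0) ->
  forall x, Q x -> exists2 y, Q y & t y = x.
Proof.
move=> dM sQ tQ tI x Qx.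
have itQ n y : Q y -> Q (iter n t y) by elim: n => //= n IH /IH /tQ.
have itI n y : Q y -> iter n t y = 0 -> y = 0.
  elim: n => //= n IH Qy /(tI _ (itQ n y Qy)); exact: IH.
have [||m mP] := dM (fun n => [set y | exists2 x, Q x & lin_iter t n x = y]%classic).
- case: (sQ) => Q0 QD QZ n; split=> [|y z [u Qu <-] [v Qv <-]|r y [u Qu <-]].
  + by exists 0 => //; apply: linear0.
  + by exists (u + v); rewrite ?linearD //; apply: QD.
  + by exists (r *: u); rewrite ?linearZ //; apply: QZ.
- by move=> n y [z Qz <-]; exists (t z); [apply: tQ | rewrite /= -iterSr].
have : [set y | exists2 x, Q x & lin_iter t m x = y]%classic (iter m t x).
  by exists x.
rewrite -(mP m.+1) // => -[y Qy]; rewrite /= -iterS iterSr => yE.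
exists y => //; apply/eqP; rewrite -subr_eq0; apply/eqP/(itI m).
  by apply: submodB => //; apply: tQ.
by rewrite -[iter m t _]/(lin_iter t m _) linearB /= yE subrr.
Qed.

(** Among the endomorphisms [a] violating the conclusion take one with least
    image, and among those one with least kernel; write [a = a a x].  Some power [f] of [a x]
    has [f] and [f f] of equal image, and satisfies [a f = a].  If [f] also
    violated the conclusion, then it would have the image and the kernel of
    [a], which makes it idempotent.  Otherwise [P] is the direct sum of the
    image [Q] of [f] and of its kernel, and composing [a] on [Q] with the
    projection to [Q] is onto [Q].  As [Q] is projective, this surjection
    splits, and so it is bijective by the descending chain condition; this
    forces the conclusion for [a]. *)
Lemma projective_fitting P (a : {linear P -> P}) : projective P -> dcc P ->
  (forall x, exists y, a x = a (a y)) -> forall z, a (a z) = 0 -> a z = 0.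
Proof.
move=> prP dP.
pose stab (a : {linear P -> P}) := forall x, exists y, a x = a (a y).
pose bad (a : {linear P -> P}) := stab a /\ exists2 z, a (a z) = 0 & a z <> 0.
suff nobad : ~ exists a, bad a.
  move=> sa z aaz; apply: contrapT => az0; apply: nobad.
  by exists a; split=> //; exists z.
move=> [a0 bad0].
pose im (a : {linear P -> P}) := [set y | exists x, a x = y]%classic.
pose ke (a : {linear P -> P}) := [set x | a x = 0]%classic.
have [|I [_ [b [badb <-]] minI]] :=
  @dcc_min _ _ (fun I => exists b, bad b /\ im b = I) dP.
  by exists (im a0); split; [apply: submod_im | exists a0].
have [|K [_ [c [badc imc <-]] minK]] :=
  @dcc_min _ _ (fun K => exists c, [/\ bad c, im c = im b & ke c = K]) dP.
  by exists (ke b); split; [apply: submod_ker | exists b].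
rewrite -{}imc in minI minK; case: (badc) => stabc [z ccz cz0].
have [x xE] : exists x : {linear P -> P}, forall y, c (c (x y)) = c y.
  apply: (@proj_lift _ _ _ _ (c \o c) c prP) => y.
  by have [y' ->] := stabc y; exists y'.
have [n fstab] := iter_range_stable (c \o x : {linear P -> P}) dP.
set f := lin_iter (c \o x : {linear P -> P}) n.+1.
have cf y : c (f y) = c y.
  by rewrite /f; elim: n.+1 => [|m IH] //; rewrite [LHS]xE.
have fs : stab f.
  move=> y; have [y' y'E] := fstab y; exists y'.
  by rewrite -![f _]/(iter n.+1 (c \o x) _) -iterD -y'E.
have imf : (im f `<=` im c)%classic by move=> y [u <-]; eexists; reflexivity.
clearbody f.
have kef : (ke f `<=` ke c)%classic.
  by move=> y; rewrite /ke /= => fy; rewrite -cf fy linear0.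
case: (pselect (bad f)) => [badf|nbadf].
  have imE : im f = im c by apply: minI => //; [exact: submod_im | exists f].
  have keE : ke f = ke c.
    by apply: minK => //; [exact: submod_ker | exists f].
  have ff y : f (f y) = f y.
    apply/eqP; rewrite -subr_eq0 -linearB; apply/eqP.
    have : ke c (f y - y) by rewrite /ke /= linearB cf subrr.
    by rewrite -keE.
  by case: badf => _ [u]; rewrite ff.
have ffI y : f (f y) = 0 -> f y = 0.
  by move=> ffy; apply: contrapT => fy; apply: nbadf; split=> //; exists y.
(* [pi] is the projection onto the image of [f] along its kernel. *)
have [l lE] : exists l : {linear P -> P}, forall y, f (f (l y)) = f y.
  apply: (@proj_lift _ _ _ _ (f \o f) f prP) => y.
  by have [y' ->] := fs y; exists y'.
pose pi : {linear P -> P} := f \o l.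
have fpi y : f (pi y) = f y by rewrite /pi /= lE.
have pif y : pi (f y) = f y.
  apply/eqP; rewrite -subr_eq0 /pi /= -linearB; apply/eqP/ffI.
  by rewrite !linearB lE subrr.
have cpi y : c (pi y) = c y.
  have : ke c (pi y - y) by apply: kef; rewrite /ke /= linearB fpi subrr.
  by rewrite /ke /= linearB => /eqP; rewrite subr_eq0 => /eqP.
have pipi y : pi (pi y) = pi y by rewrite [pi y]/(f (l y)) pif.
have impi y : exists u, c u = pi y by apply: imf; exists (l y).
clearbody pi.
(* The composite of [c] and [pi] is onto the image of [pi], hence split. *)
have [s sE] : exists s : {linear P -> P}, forall y, pi (c (pi (s y))) = pi y.
  apply: (@proj_lift _ _ _ _ (pi \o (c \o pi)) pi prP) => y.
  by have [u uE] := impi y; exists u; rewrite /= cpi uE pipi.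
pose t : {linear P -> P} := pi \o (s \o pi).
have tpi y : t (pi y) = t y by rewrite /t /= pipi.
have pict y : pi (c (t y)) = pi y by rewrite /t /= sE pipi.
have pit y : pi (t y) = t y by rewrite /t /= pipi.
clearbody t.
have tsurj y : pi y = y -> exists2 u, pi u = u & t u = y.
  move=> piy.
  have [|||u Qu <-] := @injective_on_surjective _ t
     [set y | pi y = y]%classic dP _ _ _ _ piy.
  - split=> [|u v /= uE vE|r u /= uE]; rewrite /= ?linear0 ?linearD ?linearZZ ?uE ?vE //.
  - by move=> u _; apply: pit.
  - by move=> u /= piu tu; rewrite -piu -pict tu !linear0.
  by exists u.
have cI y : pi y = y -> pi (c y) = 0 -> y = 0.
  by move=> /tsurj[u piu <-]; rewrite pict piu => ->; rewrite linear0.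
apply: cz0; rewrite -cf.
suff -> : f z = 0 by rewrite linear0.
apply: (cI) => //.
rewrite cf; apply: cI; first exact: pipi.
by rewrite cpi ccz linear0.
Qed.

Lemma fitting M (f : {linear M -> M}) : left_artinian R -> fin_gen M ->
  exists n, (forall x, exists y, iter n.+1 f x = iter n.+1 f (iter n.+1 f y)) /\
    forall x, iter n.+1 f (iter n.+1 f x) = 0 -> iter n.+1 f x = 0.
Proof.
move=> hR fgM; have [P [p [prP fgP ps]]] := free_cover fgM.
have dP := dcc_fin_gen hR fgP.
have [X XE] := prP _ _ p (f \o p) ps.
have [n nP] := iter_range_stable X dP; exists n.
have itE m y : p (iter m X y) = iter m f (p y).
  by elim: m => //= m <-; rewrite XE.
set a := lin_iter X n.+1.
have sa y : exists y', a y = a (a y').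
  have [y' y'E] := nP y; exists y'.
  by rewrite -![a _]/(iter n.+1 X _) -iterD -y'E.
have aI := projective_fitting prP dP sa.
have pa y : p (a y) = iter n.+1 f (p y) := itE n.+1 y.
split=> [x|x].
  have [y <-] := ps x; have [y' y'E] := sa y; exists (p y').
  by rewrite -!pa y'E.
have [y <-] := ps x; rewrite -!pa => pay.
(* [a] permutes the part [K] of the kernel of [p] that lies in its image. *)
pose K := [set y | p y = 0 /\ exists u, a u = y]%classic.
have sK : submod K.
  have [p0 pD pZ] := submod_ker p; have [a0 aD aZ] := submod_im a.
  split=> [|u v [? ?] [? ?]|r u [? ?]]; split;
    by [|apply: pD|apply: aD|apply: pZ|apply: aZ].
have [|||k [pk [u uE]] kE] :=
    @injective_on_surjective _ a K dP sK _ _ (a (a y)).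
- move=> v [pv _]; split; last by exists v.
  by rewrite pa pv -[iter _ _ _]/(lin_iter f n.+1 0) linear0.
- by move=> v [_ [w <-]]; apply: aI.
- by split=> //; exists (a y).
have /eqP : a (y - u) = 0.
  by apply: aI; rewrite !linearB uE kE subrr.
by rewrite linearB uE subr_eq0 => /eqP ->.
Qed.

End Fitting.

(** * Decomposition into indecomposables *)

Section Retract.
Variable R : pzRingType.
Implicit Types A B C M N X Y : lmodType R.

Definition retract A M :=
  exists (s : {linear A -> M}) (r : {linear M -> A}), forall x, r (s x) = x.

Lemma retract_refl M : retract M M.
Proof. by exists idfun, idfun. Qed.

Lemma retract_trans A B C : retract A B -> retract B C -> retract A C.
Proof.
move=> [s [r rs]] [s' [r' rs']]; exists (s' \o s), (r \o r') => x /=.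
by rewrite rs' rs.
Qed.

Lemma bij_linear_inv A B (f : {linear A -> B}) : bijective f ->
  exists2 g : {linear B -> A}, cancel f g & cancel g f.
Proof.
move=> [g fK gK].
have lg : linear g by move=> r x y; rewrite -[in LHS](gK x) -[in LHS](gK y) -linearP fK.
by exists (mk_linear lg).
Qed.

Lemma iso_retract A B : isomorphic A B -> retract A B.
Proof. by move=> [f /bij_linear_inv[g fK gK]]; exists f, g. Qed.

Lemma iso_sym A B : isomorphic A B -> isomorphic B A.
Proof. by move=> [f /bij_linear_inv[g fK gK]]; exists g, f. Qed.

Lemma iso_trans A B C : isomorphic A B -> isomorphic B C -> isomorphic A C.
Proof. by move=> [f fb] [g gb]; exists (g \o f); apply: bij_comp. Qed.

Lemma inj_surj_bij A B (f : {linear A -> B}) : injective f -> surj f -> bijective f.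
Proof. by move=> fI /choice[g gE]; exists g => // x; apply: fI; rewrite gE. Qed.

Lemma retract_compl A M (s : {linear A -> M}) (r : {linear M -> A}) :
  (forall x, r (s x) = x) ->
  exists B (j : {linear B -> M}) (q : {linear M -> B}),
    (forall y, q (j y) = y) /\ forall x, x = s (r x) + j (q x).
Proof.
move=> rs; have [B [j [jI jE]]] := submodule_exists (submod_ker r).
have [|q qE] := @factor_inj _ _ _ _ j (idfun \- (s \o r)) jI.
  by move=> x; apply/jE; rewrite /= linearB rs subrr.
exists B, j, q; split=> [y|x]; last by rewrite qE /= subrKC.
apply: jI; rewrite qE /=; have /= -> : r (j y) = 0 by apply/jE; exists y.
by rewrite linear0 subr0.
Qed.

Lemma retract_compl_iso A B M (s : {linear A -> M}) (r : {linear M -> A})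
    (j : {linear B -> M}) (q : {linear M -> B}) :
  (forall x, r (s x) = x) -> (forall y, q (j y) = y) ->
  (forall x, x = s (r x) + j (q x)) -> isomorphic M (A * B)%type.
Proof.
move=> rs qj sj; exists (pair_map r q); apply: inj_surj_bij.
  apply: linear_inj => x [rx qx]; by rewrite (sj x) rx qx !linear0 addr0.
have rj y : r (j y) = 0.
  have := congr1 r (sj (j y)).
  by rewrite linearD rs qj => /esym/(canRL (addrK _)); rewrite subrr.
have qs x : q (s x) = 0.
  have := congr1 q (sj (s x)).
  by rewrite linearD qj rs => /esym/(canRL (addrK _)); rewrite subrr.
move=> [x y]; exists (s x + j y).
by rewrite /= !linearD rs rj qs qj addr0 add0r.
Qed.

Lemma retract_indecomposable_iso N X :
  retract N X -> ~ zero_module N -> indecomposable X -> isomorphic N X.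
Proof.
move=> [s [r rs]] N0 [_ Xi].
have [B [j [q [qj sj]]]] := retract_compl rs.
have [//|B0] := Xi _ _ (retract_compl_iso rs qj sj).
exists s; exists r => // x; by rewrite [RHS](sj x) (B0 (q x)) linear0 addr0.
Qed.

Lemma retract_fin_gen A M : retract A M -> fin_gen M -> fin_gen A.
Proof. by move=> [s [r rs]]; apply: (fin_gen_surj (p := r)) => x; exists (s x). Qed.

(** The identity of [M] as a sum of idempotents factoring through
    indecomposable modules; unlike an isomorphism with a direct sum, this
    form is visibly preserved by additive functors. *)
Definition decomposes M := exists (I : finType) (X : I -> lmodType R)
    (i : forall k, {linear X k -> M}) (p : forall k, {linear M -> X k}),
  [/\ forall k, indecomposable (X k), forall k x, p k (i k x) = x &
      forall x, x = \sum_k i k (p k x)].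

Lemma decomposes_prod A B : decomposes A -> decomposes B ->
  decomposes (A * B)%type.
Proof.
move=> [I [X [i [p [Xi pi ip]]]]] [J [Y [j [q [Yi qj jq]]]]].
pose Z (k : I + J) : lmodType R := match k with inl k => X k | inr k => Y k end.
pose iZ (k : I + J) : {linear Z k -> (A * B)%type} :=
  match k return {linear Z k -> (A * B)%type} with
  | inl k => pair_map (i k) \0 | inr k => pair_map \0 (j k) end.
pose pZ (k : I + J) : {linear (A * B)%type -> Z k} :=
  match k return {linear (A * B)%type -> Z k} with
  | inl k => p k \o fst | inr k => q k \o snd end.
exists (I + J)%type, Z, iZ, pZ.
split; [by case|by case=> k x; [exact: pi|exact: qj]|] => -[x y].
rewrite big_sumType /= [in LHS](ip x) [in LHS](jq y).
have -> (u : I -> A) (v : J -> B) : (\sum_k u k, \sum_k v k) =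
    (\sum_k u k, 0 : B) + (0 : A, \sum_k v k).
  by rewrite pair_addE addr0 add0r.
congr (_ + _).
  exact: (linear_sum (pair_map (idfun : {linear A -> A}) (\0 : {linear A -> B}))).
exact: (linear_sum (pair_map (\0 : {linear B -> A}) (idfun : {linear B -> B}))).
Qed.

Lemma decomposes_iso A M : isomorphic M A -> decomposes A -> decomposes M.
Proof.
move=> [f /bij_linear_inv[g fK gK]] [I [X [i [p [Xi pi ip]]]]].
exists I, X, (fun k => g \o i k), (fun k => p k \o f).
split=> // [k x|x] /=; first by rewrite gK pi.
by rewrite -linear_sum -ip fK.
Qed.

(** A minimal submodule without a decomposition would be the direct sum of two
    smaller submodules. *)
Lemma dcc_decomposes M : dcc M -> decomposes M.
Proof.
move=> dM; apply: contrapT => nM.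
have [|V [sV [S [i [iI iV nS]]] minV]] := @dcc_min _ _ (fun V : set M =>
    exists (S : lmodType R) (i : {linear S -> M}), [/\ injective i,
      forall x, V x <-> exists u, i u = x & ~ decomposes S]) dM.
  by exists setT; split=> //; exists M, idfun; split=> // x; split=> // _; exists x.
have SN0 : ~ zero_module S.
  move=> S0; apply: nS; exists 'I_0, (fun=> S), (fun=> idfun), (fun=> idfun).
  by split=> [[]|//|x]; rewrite // big_ord0.
have [A [B [[f /bij_linear_inv[g fK gK]] A0 B0]]] :
    exists A B, [/\ isomorphic S (A * B)%type, ~ zero_module A & ~ zero_module B].
  apply: contrapT => nAB; apply: nS.
  exists 'I_1, (fun=> S), (fun=> idfun), (fun=> idfun); split=> //.
    move=> _; split=> // A B SAB; apply: contrapT => /not_orP[A0 B0].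
    by apply: nAB; exists A, B.
  by move=> x; rewrite big_ord1.
have sub (C : lmodType R) (h : {linear C -> S}) :
    injective h -> (exists y, ~ exists u, h u = y) -> decomposes C.
  move=> hI [y ny]; apply: contrapT => nC.
  have /= hN : [set x | exists u, (i \o h) u = x]%classic = V.
    apply: minV => [||x [u <-]]; [exact: submod_im | | by apply/iV; exists (h u)].
    by exists C, (i \o h); split=> //; apply: inj_comp.
  have : V (i y) by apply/iV; exists y.
  by rewrite -hN => -[u /iI hu]; apply: ny; exists u.
apply: nS; apply: (@decomposes_iso (A * B)%type); first by exists f, g.
apply: decomposes_prod.
  apply: (sub _ (g \o pair_map idfun \0)) => [x y /(can_inj gK)[]//|].
  have [b b0] : exists b : B, b <> 0.
    by apply: contrapT => nb; apply: B0 => b; apply: contrapT => b0; apply: nb; exists b.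
  by exists (g (0, b)) => -[u /(can_inj gK)[_ /esym]].
apply: (sub _ (g \o pair_map \0 idfun)) => [x y /(can_inj gK)[]//|].
have [b b0] : exists b : A, b <> 0.
  by apply: contrapT => nb; apply: A0 => b; apply: contrapT => b0; apply: nb; exists b.
by exists (g (b, 0)) => -[u /(can_inj gK)[/esym]].
Qed.

End Retract.

Section KrullSchmidt.
Variable R : pzRingType.
Hypothesis hR : left_artinian R.
Implicit Types A B C M N X Y : lmodType R.

Lemma indecomposable_nilpotent_or_bij N (f : {linear N -> N}) :
  fin_gen N -> indecomposable N ->
  bijective f \/ exists n, forall x, iter n f x = 0.
Proof.
move=> fgN [N0 Ni]; have [n [fs fI]] := fitting f hR fgN.
set g := lin_iter f n.+1.
have gs x : exists y, g x = g (g y) := fs x.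
have gI x : g (g x) = 0 -> g x = 0 := fI x.
have gE x : g x = iter n.+1 f x by [].
clearbody g; clear fs fI.
have [A [i [iI imi]]] := submodule_exists (submod_im g).
have [K [j [jI imj]]] := submodule_exists (submod_ker g).
have [] := Ni A K.
- apply/iso_sym; exists (copair_map i j); apply: inj_surj_bij.
    apply: linear_inj => -[x y] /= xy0.
    have [z /= zE] : exists z, g z = i x by apply/imi; exists x.
    have jy : g (j y) = 0 by apply/imj; exists y.
    have gz : g z = 0.
      apply: gI; have := congr1 g xy0; rewrite linearD jy addr0 linear0 -zE.
      by [].
    move: xy0; rewrite -zE gz add0r => /(inj_eq0 jI) ->.
    by congr pair; apply: iI; rewrite -zE gz linear0.
  move=> x; have [y yE] := gs x.
  have [a aE] : exists a, i a = g y by apply/imi; exists y.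
  have [b bE] : exists b, j b = x - g y.
    by apply/imj; rewrite /= linearB yE subrr.
  by exists (a, b); rewrite /= aE bE subrKC.
- move=> A0; right; exists n.+1 => x; rewrite -gE.
  have [a <-] : exists a, i a = g x by apply/imi; exists x.
  by rewrite (A0 a) linear0.
move=> K0; left.
have g0 x : g x = 0 -> x = 0.
  by move=> /imj[b <-]; rewrite (K0 b) linear0.
apply: inj_surj_bij.
  apply: linear_inj => x fx; apply: g0; rewrite gE iterSr fx.
  by rewrite -[iter n f 0]/(lin_iter f n 0) linear0.
move=> x; have [y yE] := gs x; exists (iter n f y).
rewrite -iterS -gE; apply/eqP; rewrite eq_sym -subr_eq0; apply/eqP/g0.
by rewrite linearB yE subrr.
Qed.

(** The endomorphism ring is local: if [u] is nilpotent then [1 - u] is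
    inverted by the geometric series. *)
Lemma local_endo N (u v : {linear N -> N}) : fin_gen N -> indecomposable N ->
  (forall x, u x + v x = x) -> bijective u \/ bijective v.
Proof.
move=> fgN Ni uv; have [|[n un]] := indecomposable_nilpotent_or_bij u fgN Ni.
  by left.
have vE x : v x = x - u x by rewrite -{2}(uv x) addrC addKr.
right; apply: inj_surj_bij.
  apply: linear_inj => x; rewrite vE => /eqP; rewrite subr_eq0 => /eqP xu.
  by rewrite -(un x); elim: n {un} => //= n <-.
move=> y; exists (\sum_(k < n) iter k u y); rewrite linear_sum.
under eq_bigr => k _ do rewrite vE -iterS.
rewrite -(big_mkord xpredT (fun k => iter k u y - iter k.+1 u y)).
by rewrite (telescope_sumr_eq (fun k => - iter k u y)) ?un ?oppr0 ?sub0r ?opprK //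
  => k _; rewrite opprK addrC.
Qed.

Lemma local_endo_sum N (I : finType) (u : I -> {linear N -> N}) :
  fin_gen N -> indecomposable N ->
  (forall x, x = \sum_i u i x) -> exists i, bijective (u i).
Proof.
move=> fgN Ni sumu.
suff H (s : seq I) : bijective (fun x => \sum_(i <- s) u i x) ->
    exists i, bijective (u i).
  by apply: (H (index_enum I)); exists idfun => x; rewrite /= -sumu.
elim: s => [[g gK _]|i s IH].
  by case: Ni => N0 _; case: N0 => x; rewrite -(gK x) -[RHS](gK 0) /= !big_nil.
have lw : linear (fun x => \sum_(i <- s) u i x).
  move=> r x y; rewrite scaler_sumr -big_split /=.
  by apply: eq_bigr => j _; rewrite linearP.
have lt : linear (fun x => \sum_(i <- i :: s) u i x).
  move=> r x y; rewrite scaler_sumr -big_split /=.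
  by apply: eq_bigr => j _; rewrite linearP.
move=> tb; have [g gK Kg] := @bij_linear_inv _ _ _ (mk_linear lt) tb.
have gb : bijective g by exists (mk_linear lt).
have [|gu|gw] := @local_endo N (g \o u i) (g \o mk_linear lw) fgN Ni.
- by move=> x /=; rewrite -linearD -[in RHS](gK x) /= big_cons.
- exists i; apply: (eq_bij (f := (mk_linear lt) \o (g \o u i))) => [|x /=].
    by apply: bij_comp.
  exact: Kg.
apply: IH; apply: (eq_bij (f := (mk_linear lt) \o (g \o mk_linear lw))) => [|x /=].
  by apply: bij_comp.
exact: Kg.
Qed.

Lemma retract_of_sum N M (I : finType) (X : I -> lmodType R)
    (i : forall k, {linear X k -> M}) (p : forall k, {linear M -> X k}) :
  fin_gen N -> indecomposable N -> retract N M ->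
  (forall x, x = \sum_k i k (p k x)) -> exists k, retract N (X k).
Proof.
move=> fgN Ni [s [r rs]] ip.
have [|k /bij_linear_inv[g gK _]] :=
    @local_endo_sum N _ (fun k => r \o (i k \o (p k \o s))) fgN Ni.
  by move=> x /=; rewrite -linear_sum -ip rs.
by exists k, (p k \o s), (g \o (r \o i k)).
Qed.

End KrullSchmidt.

(** By the Krull-Schmidt property, an indecomposable [N] in [CS] is a retract of
    [F X] for some indecomposable summand [X] of [U N], since it is a retract of
    [F (U N)].  Up to isomorphism there are finitely many such [X], and each
    [F X] has only finitely many indecomposable summands.  The last assumption
    on [F] is its additivity, in the form in which it is applied to a
    decomposition of [U N]. *)
Lemma finite_rep_type_transfer (R S : pzRingType)
    (CR : lmodType R -> Prop) (CS : lmodType S -> Prop)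
    (F : lmodType R -> lmodType S) (U : lmodType S -> lmodType R) :
  left_artinian R -> left_artinian S ->
  (forall M, CR M -> fin_gen M) -> (forall N, CS N -> fin_gen N) ->
  (forall A M, retract A M -> CR M -> CR A) ->
  (forall N, CS N -> CR (U N)) -> (forall N, CS N -> retract N (F (U N))) ->
  (forall M, fin_gen M -> fin_gen (F M)) ->
  (forall A B, isomorphic A B -> retract (F A) (F B)) ->
  (forall (M : lmodType R) (I : finType) (X : I -> lmodType R)
     (i : forall k, {linear X k -> M}) (p : forall k, {linear M -> X k}),
     (forall x, x = \sum_k i k (p k x)) ->
     exists (i' : forall k, {linear F (X k) -> F M})
            (p' : forall k, {linear F M -> F (X k)}),
       forall x, x = \sum_k i' k (p' k x)) ->
  finite_rep_type CR -> finite_rep_type CS.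
Proof.
move=> hR hS fgR fgS CRr CSU rFU Ffg Fiso Fsum [n [X XP]].
have decF (k : 'I_n) : exists Y : {I : finType & I -> lmodType S},
    (forall l, indecomposable (projT2 Y l)) /\
    forall N M, CS N -> indecomposable N -> CR M -> isomorphic M (X k) ->
      retract N (F M) -> exists l, isomorphic N (projT2 Y l).
  case: (pselect (exists2 M, CR M & isomorphic M (X k))) => [[M0 CM0 M0X]|nM].
    have [I [Y [i [p [Yi _ ip]]]]] :=
      dcc_decomposes (dcc_fin_gen hS (Ffg _ (fgR _ CM0))).
    exists (existT _ I Y); split=> //= N M CN Ni CM MX NFM.
    have NFM0 : retract N (F M0).
      apply: retract_trans NFM (Fiso _ _ _).
      exact: iso_trans MX (iso_sym M0X).
    have [l Nl] := retract_of_sum hS (fgS _ CN) Ni NFM0 ip.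
    by exists l; apply: retract_indecomposable_iso Nl _ (Yi l); case: Ni.
  exists (existT _ ('I_0 : finType) (fun=> {ffun 'I_0 -> S^o} : lmodType S)).
  split=> [[]//|].
  by move=> N M _ _ CM MX; case: nM; exists M.
have /choice[Y YP] := decF.
pose J : finType := {k : 'I_n & projT1 (Y k)}.
exists #|J|, (fun j => projT2 (Y _) (tagged (enum_val j : J))) => N CN Ni.
have CUN := CSU _ CN.
have [K [Z [i [p [Zi pi ip]]]]] := dcc_decomposes (dcc_fin_gen hR (fgR _ CUN)).
have [i' [p' ip']] := Fsum _ _ _ _ _ ip.
have [k Nk] := retract_of_sum hS (fgS _ CN) Ni (rFU _ CN) ip'.
have CZ : CR (Z k) by apply: CRr CUN; exists (i k), (p k).
have [m Zm] := XP _ CZ (Zi k).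
have [_ /(_ _ _ CN Ni CZ Zm Nk)[l Nl]] := YP m.
by exists (enum_rank (Tagged (fun k => projT1 (Y k)) l)); rewrite enum_rankK.
Qed.

(** * Syzygies and the vanishing of Ext *)

Section Syzygies.
Variable R : pzRingType.
Implicit Types A B C K M N P Q T X Y Z : lmodType R.

Definition ses K P N (i : {linear K -> P}) (p : {linear P -> N}) :=
  [/\ injective i, exact_at i p & surj p].

Definition extends_along Q K P (i : {linear K -> P}) :=
  forall u : {linear K -> Q}, exists v : {linear P -> Q}, forall x, v (i x) = u x.

Definition syzygy K N := exists P (i : {linear K -> P}) (p : {linear P -> N}),
  projective P /\ ses i p.

Lemma exact_comp A B C (f : {linear A -> B}) (g : {linear B -> C}) x :
  exact_at f g -> g (f x) = 0.
Proof. by move=> fg; apply/fg; exists x. Qed.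

(** Dependent choice.  A class closed under syzygies brings along the
    projectives from which the resolutions are built. *)
Lemma resolution_of_class (C : lmodType R -> Prop) :
  (forall N, C N -> exists2 K, C K & syzygy K N) ->
  forall N, C N -> inhabited (projective_resolution N).
Proof.
move=> stepC N CN.
have /choice[next nextP] (u : {N | C N}) :
    exists v : {N | C N}, syzygy (sval v) (sval u).
  by case: u => M /= /stepC[K CK sK]; exists (exist _ K CK).
pose Z n : lmodType R := sval (iter n next (exist _ N CN)).
have WP n : {W : {P : lmodType R & ({linear Z n.+1 -> P} * {linear P -> Z n})%type}
    | projective (projT1 W) /\ ses (projT2 W).1 (projT2 W).2}.
  apply: cid; have [P [i [p H]]] := nextP (iter n next (exist _ N CN)).
  by exists (existT _ P (i, p)).
pose W n := sval (WP n); pose i n := (projT2 (W n)).1; pose p n := (projT2 (W n)).2.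
have WE n := svalP (WP n).
have ip n : ses (i n) (p n) by case: (WE n).
constructor; apply: (@ProjectiveResolution R N (fun n => projT1 (W n))
  (fun n => i n \o p n.+1) (p 0%N)).
- by move=> n; case: (WE n).
- by case: (ip 0%N).
- move=> y; case: (ip 0%N) => _ ex _; case: (ip 1%N) => _ _ p1s.
  split=> [/ex[z <-]|[x <-]]; last exact: exact_comp ex.
  by have [x <-] := p1s z; exists x.
move=> n y; case: (ip n) => iI _ _; case: (ip n.+1) => _ ex _.
case: (ip n.+2) => _ _ ps.
split=> /= [/(inj_eq0 iI)/ex[z <-]|[x <-]].
  by have [x <-] := ps z; exists x.
by rewrite (exact_comp _ ex) linear0.
Qed.

Definition resolution_cons_obj K P (rK : projective_resolution K) n : lmodType R :=
  if n is m.+1 then pr_obj rK m else P.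

Definition resolution_cons_d K P (i : {linear K -> P}) (rK : projective_resolution K) n :
    {linear resolution_cons_obj P rK n.+1 -> resolution_cons_obj P rK n} :=
  match n return {linear resolution_cons_obj P rK n.+1 -> resolution_cons_obj P rK n} with
  | 0 => i \o pr_aug rK
  | m.+1 => pr_d rK m
  end.

Lemma resolution_cons K P N (i : {linear K -> P}) (p : {linear P -> N})
    (rK : projective_resolution K) : projective P -> ses i p ->
  exists rN : projective_resolution N,
    [/\ forall Q, extends_along Q i -> hom_exact_at Q (pr_d rN 1) (pr_d rN 0) &
        forall Q n, hom_exact_at Q (pr_d rK n.+1) (pr_d rK n) ->
          hom_exact_at Q (pr_d rN n.+2) (pr_d rN n.+1)].
Proof.
move=> prP [iI ex ps].
have r0 : forall n, projective (resolution_cons_obj P rK n).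
  by case=> //= n; apply: pr_proj.
have r1 : exact_at (resolution_cons_d i rK 0) p.
  move=> y; split=> [/ex[k <-]|[x <-]]; last exact: exact_comp ex.
  by have [x <-] := pr_aug_surj rK k; exists x.
have r2 n : exact_at (resolution_cons_d i rK n.+1) (resolution_cons_d i rK n).
  case: n => [|n] y /=; last exact: pr_exactS.
  by rewrite -pr_exact0 /=; split=> [/(inj_eq0 iI)|->]; rewrite ?linear0.
exists (ProjectiveResolution r0 ps r1 r2); split=> //= Q iQ u /=.
split=> [ud|[v vE] x]; last by rewrite -vE /= (_ : pr_aug rK _ = 0) ?linear0 //;
  apply/pr_exact0; exists x.
have [|w wE] := @factor_surj _ _ _ _ (pr_aug rK) u (pr_aug_surj rK).
  by move=> x /pr_exact0[y <-].
by have [v vE] := iQ w; exists v => y; rewrite vE wE.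
Qed.

Lemma resolution_tail N (r : projective_resolution N) :
  exists K (i : {linear K -> pr_obj r 0}) (rK : projective_resolution K),
    [/\ ses i (pr_aug r),
        forall Q, hom_exact_at Q (pr_d r 1) (pr_d r 0) -> extends_along Q i &
        forall Q n, hom_exact_at Q (pr_d r n.+2) (pr_d r n.+1) ->
          hom_exact_at Q (pr_d rK n.+1) (pr_d rK n)].
Proof.
have [K [i [iI iE]]] := submodule_exists (submod_ker (pr_aug r)).
have [|p pE] := @factor_inj _ _ _ _ i (pr_d r 0) iI.
  by move=> x; apply/iE; rewrite /= (exact_comp _ (@pr_exact0 _ _ r)).
have ps : surj p.
  move=> k; have /= /pr_exact0[x xE] : pr_aug r (i k) = 0 by apply/iE; exists k.
  by exists x; apply: iI; rewrite pE.
have p1 : exact_at (pr_d r 1) p.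
  move=> y; rewrite -(@pr_exactS _ _ r 0 y) -pE.
  by split=> [->|/(inj_eq0 iI)]; rewrite ?linear0.
pose rK := @ProjectiveResolution R K (fun n => pr_obj r n.+1)
  (fun n => pr_d r n.+1) p (fun n => @pr_proj _ _ r n.+1) ps p1
  (fun n => @pr_exactS _ _ r n.+1).
exists K, i, rK; split=> [||//].
  by split; [exact: iI | move=> y; apply: iE | exact: pr_aug_surj].
move=> Q Qex u; have [v vE] : exists v : {linear pr_obj r 0 -> Q},
    forall y, v (pr_d r 0 y) = (u \o p) y.
  apply/Qex => x /=; rewrite (_ : p _ = 0) ?linear0 //.
  by apply/p1; exists x.
exists v => k; have [x <-] := ps k; by rewrite pE vE.
Qed.

Lemma resolution_syzygy N : inhabited (projective_resolution N) ->
  exists2 K, inhabited (projective_resolution K) & syzygy K N.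
Proof.
move=> [r]; have [K [i [rK [ir _ _]]]] := resolution_tail r.
by exists K => //; exists (pr_obj r 0), i, (pr_aug r); split=> //; apply: pr_proj.
Qed.

Lemma ext1_zeroP N Q : ext_zero 1 N Q <->
  exists K P (i : {linear K -> P}) (p : {linear P -> N}),
    [/\ inhabited (projective_resolution K), projective P, ses i p &
        extends_along Q i].
Proof.
split=> [[r Qex]|[K [P [i [p [[rK] prP sip iQ]]]]]].
  have [K [i [rK [ir iQ _]]]] := resolution_tail r.
  exists K, (pr_obj r 0), i, (pr_aug r).
  by split=> //; [apply: pr_proj | apply: iQ].
have [rN [rQ _]] := resolution_cons rK prP sip.
by exists rN; apply: rQ.
Qed.

Lemma extS_zeroP n N Q : ext_zero n.+2 N Q <->
  exists2 K, syzygy K N & ext_zero n.+1 K Q.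
Proof.
split=> [[r Qex]|[K [P [i [p [prP sip]]]] [rK Qex]]].
  have [K [i [rK [ir _ iQ]]]] := resolution_tail r.
  exists K; last by exists rK; apply: iQ.
  by exists (pr_obj r 0), i, (pr_aug r); split=> //; apply: pr_proj.
have [rN [_ rQ]] := resolution_cons rK prP sip.
by exists rN; apply: rQ.
Qed.

End Syzygies.

(** Dimension shifting turns Ext^(n+1) of [N] into Ext^1 of an n-th syzygy, and
    syzygies can be followed along [rel].  The relations of interest are being
    a direct summand up to projectives, being the restriction, and being the
    induced module. *)
Lemma ext_zero_simulation (R S : pzRingType) (Q : lmodType R) (Q' : lmodType S)
    (rel : lmodType S -> lmodType R -> Prop) :
  (forall (N' : lmodType S) (N K P : lmodType R)
     (i : {linear K -> P}) (p : {linear P -> N}),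
     rel N' N -> projective P -> ses i p ->
     exists (K' P' : lmodType S) (i' : {linear K' -> P'}) (p' : {linear P' -> N'}),
       [/\ rel K' K, projective P', ses i' p' &
           extends_along Q i -> extends_along Q' i']) ->
  forall n N' N, rel N' N -> ext_zero n.+1 N Q -> ext_zero n.+1 N' Q'.
Proof.
move=> relS.
have res N' N : rel N' N -> inhabited (projective_resolution N) ->
    inhabited (projective_resolution N').
  move=> NN rN; apply: (@resolution_of_class _ (fun N' => exists2 N, rel N' N &
    inhabited (projective_resolution N))); last by exists N.
  move=> {N NN rN}N'.
  move=> [N NN /resolution_syzygy[K rK [P [i [p [prP sip]]]]]].
  have [K' [P' [i' [p' [KK prP' sip' _]]]]] := relS _ _ _ _ _ _ NN prP sip.
  by exists K'; [exists K | exists P', i', p'].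
elim=> [|n IH] N' N NN.
  move=> /ext1_zeroP[K [P [i [p [rK prP sip iQ]]]]]; apply/ext1_zeroP.
  have [K' [P' [i' [p' [KK prP' sip' iQ']]]]] := relS _ _ _ _ _ _ NN prP sip.
  by exists K', P', i', p'; split=> //; [apply: res KK rK | apply: iQ'].
move=> /extS_zeroP[K [P [i [p [prP sip]]]] eK]; apply/extS_zeroP.
have [K' [P' [i' [p' [KK prP' sip' _]]]]] := relS _ _ _ _ _ _ NN prP sip.
by exists K'; [exists P', i', p' | apply: IH KK eK].
Qed.

Section StableRetracts.
Variable R : pzRingType.
Implicit Types A B C K M N P Q T X Y Z : lmodType R.

(** [N'] is a direct summand of [N] up to a projective summand: the identity
    of [N'] factors through [N] modulo maps that factor through projectives. *)
Definition stable_retract N' N := exists T (s : {linear N' -> N})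
    (r : {linear N -> N'}) (al : {linear N' -> T}) (be : {linear T -> N'}),
  projective T /\ forall y, y = r (s y) + be (al y).

Lemma retract_stable N' N : retract N' N -> stable_retract N' N.
Proof.
move=> [s [r rs]]; exists {ffun 'I_0 -> R^o}, s, r, \0, \0.
by split=> [|y]; [exact: free_projective | rewrite rs /= addr0].
Qed.

(** The middle term [P * T] maps onto [N'] by [r p] and [be]; the identity of
    [P * T] differs from its factorisations through [P] and [T] by a map [th]
    into the new syzygy [K'], and restricting [th] to [K'] shows that [K'] is
    again a stable retract of [K]. *)
Lemma stable_retract_syzygy N' N K P (i : {linear K -> P}) (p : {linear P -> N}) :
  stable_retract N' N -> projective P -> ses i p ->
  exists K' P' (i' : {linear K' -> P'}) (p' : {linear P' -> N'}),
    [/\ stable_retract K' K, projective P', ses i' p' &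
        forall Q, extends_along Q i -> extends_along Q i'].
Proof.
move=> [T [s [r [al [be [prT rs]]]]]] prP [iI ex ps].
pose p' : {linear (P * T)%type -> N'} := copair_map (r \o p) be.
have [K' [i' [i'I i'E]]] := submodule_exists (submod_ker p').
have prP' := proj_prod prP prT.
have p's : surj p'.
  move=> y; have [x xE] := ps (s y); exists (x, al y).
  by rewrite /= xE -rs.
have ex' : exact_at i' p' by move=> y; apply: i'E.
have [t tE] := prP' _ _ p (s \o p') ps.
pose rP : {linear P -> (P * T)%type} := pair_map idfun \0.
pose bT : {linear T -> (P * T)%type} := pair_map \0 idfun.
have p'r x : p' (rP x) = r (p x) by rewrite /= linear0 addr0.
have p'b x : p' (bT x) = be x by rewrite /= !linear0 add0r.
have [th thE] : exists th : {linear (P * T)%type -> K'}, forall x,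
    i' (th x) = ((idfun \- (rP \o t)) \- (bT \o (al \o p'))) x.
  apply: factor_inj i'I _ => x; apply/ex'.
  rewrite [X in p' X]/= !linearB p'r p'b tE.
  by rewrite {1}[p' x]rs addrAC addrK subrr.
clearbody p' rP bT.
have [tK tKE] : exists tK : {linear K' -> K}, forall x, i (tK x) = (t \o i') x.
  by apply: factor_inj iI _ => x; apply/ex; rewrite /= tE /= (exact_comp _ ex') linear0.
have [rK rKE] : exists rK : {linear K -> K'}, forall x, i' (rK x) = (rP \o i) x.
  by apply: factor_inj i'I _ => x; apply/ex'; rewrite /= p'r (exact_comp _ ex) linear0.
have idK x : x = rK (tK x) + th (i' x).
  apply: i'I; rewrite linearD rKE thE /= tKE /= (exact_comp _ ex') !linear0.
  by rewrite addr0 subrKC.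
exists K', (P * T)%type, i', p'; split=> //.
  by exists (P * T)%type, tK, rK, i', th.
move=> Q iQ u; have [w wE] := iQ (u \o rK).
exists ((w \o t) \+ (u \o th)) => x /=.
rewrite [in RHS](idK x) linearD; congr (_ + _).
by rewrite -[RHS]wE tKE.
Qed.

Lemma stable_retract_ext_zero n N' N Q :
  stable_retract N' N -> ext_zero n.+1 N Q -> ext_zero n.+1 N' Q.
Proof.
apply: ext_zero_simulation => {}N' {}N K P i p NN prP sip.
have [K' [P' [i' [p' [KK prP' sip' iQ]]]]] := stable_retract_syzygy NN prP sip.
by exists K', P', i', p'; split=> //; apply: iQ.
Qed.

End StableRetracts.

(** * Transposes of direct summands *)

Section TransposeRetract.
Variable R : pzRingType.
Implicit Types A B C K M P Q : lmodType R.

Lemma dual_basis P : fin_gen P -> projective P ->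
  exists n (e : 'I_n -> P) (xi : 'I_n -> dual P),
    forall x, x = \sum_i (xi i x : R) *: e i.
Proof.
move=> [n [e eP]] prP.
have [|h hE] := prP _ _ (mk_linear (lincomb_linear e)) idfun.
  move=> x; have [c ->] := eP x; exists [ffun i => c i] => /=.
  by apply: eq_bigr => i _; rewrite ffunE.
have lxi i : linear (fun x => h x i : R^o).
  by move=> r x y; rewrite linearP !ffunE.
exists n, e, (fun i => mk_dual (lxi i)) => x.
by rewrite [LHS](esym (hE x)).
Qed.

Lemma dual_sum_apply P I (s : seq I) (F : I -> dual P) x :
  (\sum_(i <- s) F i : dual P) x = \sum_(i <- s) F i x.
Proof. by elim/big_rec2: _ => // i u v _ <-. Qed.

(** With a dual basis of [P], a lift of [f] is determined by lifting its values
    on the coordinate functionals. *)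
Lemma dual_projective P : fin_gen P -> projective P ->
  projective (dual P : lmodType R^c).
Proof.
move=> fgP prP A B q f qs.
have [n [e [xi xiE]]] := dual_basis fgP prP.
have /choice[a aE] i : exists a, q a = f (xi i) by apply: qs.
have lh : linear (fun u : dual P => \sum_i (u (e i) : R^c) *: a i).
  move=> r u v; rewrite scaler_sumr -big_split /=.
  by apply: eq_bigr => i _; rewrite scalerDl scalerA.
exists (mk_linear lh) => u /=; rewrite linear_sum.
under eq_bigr => i _ do rewrite linearZZ aE -linearZZ.
rewrite -linear_sum; congr (f _); apply: dualP => x.
rewrite dual_sum_apply [in RHS](xiE x) linear_sum.
by apply: eq_bigr => i _; rewrite linearZZ.
Qed.

(** With a presentation [f : P1 -> P0] of [M] and [A] a retract of [M] by [s]
    and [r], lift the idempotent [s r] to [t : P0 -> P0]; then [A] is presented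
    by [(f, 1 - t) : P1 * P0 -> P0].  The identity of the transpose [N'] of [A]
    is the sum of a map through the transpose [N] of [M] and of one induced by
    the dual of [th], which factors through the projective [dual (P1 * P0)]. *)
Lemma transpose_retract A M (N : lmodType R^c) : retract A M -> is_transpose M N ->
  exists2 N' : lmodType R^c, is_transpose A N' & stable_retract N' N.
Proof.
move=> [s [r rs]] [P1 [P0 [f [p [q [[fg1 pr1] [fg0 pr0] [ex ps] [exq qs]]]]]]].
have [t tE] := pr0 _ _ p (s \o (r \o p)) ps.
pose f' : {linear (P1 * P0)%type -> P0} := copair_map f (idfun \- t).
pose p' : {linear P0 -> A} := r \o p.
have f'E x : f' x = f x.1 + (x.2 - t x.2) by [].
have p'E x : p' x = r (p x) by [].
clearbody f' p'.
have p'f' x : p' (f' x) = 0.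
  rewrite p'E f'E linearD (exact_comp _ ex) add0r linearB tE /=.
  by rewrite linearB rs subrr.
have ex' : exact_at f' p'.
  move=> z; split=> [|[x <-] //]; rewrite p'E => rpz.
  have /ex[y yE] : p (t z) = 0 by rewrite tE /= rpz linear0.
  by exists (y, z); rewrite f'E /= yE subrKC.
have p's : surj p'.
  move=> y; have [x xE] := ps (s y); by exists x; rewrite p'E xE rs.
have fg' := fin_gen_prod fg1 fg0; have pr' := proj_prod pr1 pr0.
have [N' [q' [q's q'E]]] := quotient_exists (submod_im (dual_map f')).
have exq' : exact_at (dual_map f') q' by move=> y; apply: q'E.
exists N'; first by exists (P1 * P0)%type, P0, f', p', q'; split=> //; split.
(* [s1] lifts [s] to the first terms of the presentations. *)
have [s1 s1E] : exists s1 : {linear (P1 * P0)%type -> P1}, forall y, f (s1 y) = t (f' y).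
  apply: (@proj_lift _ _ _ _ f (t \o f') pr') => y; apply/ex.
  by rewrite /= tE /= -p'E p'f' linear0.
pose r1 : {linear P1 -> (P1 * P0)%type} := pair_map idfun \0.
pose h0 : {linear P0 -> (P1 * P0)%type} := pair_map \0 idfun.
have f'r x : f' (r1 x) = f x by rewrite f'E linear0 subrr addr0.
have f'h x : f' (h0 x) = x - t x by rewrite f'E linear0 add0r.
pose th : {linear (P1 * P0)%type -> (P1 * P0)%type} :=
  (idfun \- (r1 \o s1)) \- (h0 \o f').
have thE x : th x = x - r1 (s1 x) - h0 (f' x) by [].
have f'th x : f' (th x) = 0.
  by rewrite thE !linearB f'r s1E f'h subrr.
clearbody th r1 h0.
have [sg sgE] : exists sg : {linear N' -> N}, forall w, sg (q' w) = (q \o dual_map r1) w.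
  apply: factor_surj q's _ => w /exq'[v <-] /=.
  by apply/exq; exists v; apply: dualP => x /=; rewrite f'r.
have [rh rhE] : exists rh : {linear N -> N'}, forall w, rh (q w) = (q' \o dual_map s1) w.
  apply: factor_surj qs _ => w /exq[v <-] /=.
  by apply/exq'; exists (dual_map t v); apply: dualP => x /=; rewrite s1E.
have [al alE] : exists al : {linear N' -> dual (P1 * P0)%type},
    forall w, al (q' w) = dual_map th w.
  apply: factor_surj q's _ => w /exq'[v <-] /=.
  by apply: dualP => x /=; rewrite f'th linear0.
exists (dual (P1 * P0)%type : lmodType R^c), sg, rh, al, q'.
split=> [|y]; first exact: dual_projective.
have [w <-] := q's y; rewrite sgE rhE alE /= -linearD.
apply/eqP; rewrite -subr_eq0 -linearB; apply/eqP/exq'.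
exists (dual_map h0 w); apply: dualP => x /=.
rewrite -[in RHS]/(w x - (w (r1 (s1 x)) + w (th x))) -linearD -linearB.
by rewrite thE [X in _ - X]addrA subrKC opprB subrKC.
Qed.

Lemma TF_retract k A M : retract A M -> TF k M -> TF k A.
Proof.
move=> AM [fgM [N [MN eN]]]; split; first exact: retract_fin_gen fgM.
have [N' AN' NN] := transpose_retract AM MN; exists N'; split=> // -[//|i] ik.
exact: stable_retract_ext_zero NN (eN _ ik).
Qed.

End TransposeRetract.

(** * Gorenstein projective modules *)

Section Gorenstein.
Variable R : pzRingType.
Implicit Types A B C K M N P Q X Y Z : lmodType R.

(** One step of a totally acyclic complex, seen from its syzygies. *)
Definition acyclic_step X Y :=
  exists P (i : {linear X -> P}) (p : {linear P -> Y}),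
    [/\ projective P, ses i p & forall Q, projective Q -> extends_along Q i].

Lemma acyclic_step_chain (C : lmodType R -> Prop)
    (rel : lmodType R -> lmodType R -> Prop) :
  (forall X, C X -> exists2 Y, C Y & rel X Y) ->
  forall X, C X ->
  exists2 Z : nat -> lmodType R, Z 0%N = X & forall n, rel (Z n) (Z n.+1).
Proof.
move=> stepC X CX.
have /choice[next nextP] (u : {N | C N}) : exists v : {N | C N}, rel (sval u) (sval v).
  by case: u => M /= /stepC[K CK sK]; exists (exist _ K CK).
by exists (fun n => sval (iter n next (exist _ X CX))) => // n; apply: nextP.
Qed.

(** The complex is assembled by dependent choice in both directions.  Since
    [acyclic_step] is a proposition about two consecutive syzygies, identities
    between integer indices can be rewritten before terms and differentials
    are chosen. *)
Lemma gorenstein_projective_coind (C : lmodType R -> Prop) :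
  (forall X, C X -> exists2 Y, C Y & acyclic_step X Y) ->
  (forall Y, C Y -> exists2 X, C X & acyclic_step X Y) ->
  forall M, C M -> gorenstein_projective M.
Proof.
move=> up down M CM.
have [U U0 US] := acyclic_step_chain up CM.
have [V V0 VS] := acyclic_step_chain (rel := fun X Y => acyclic_step Y X) down CM.
pose Z (k : int) := match k with Posz n => V n | Negz n => U n.+1 end.
have ZS (k : int) : acyclic_step (Z (k + 1)) (Z k).
  case: k => [n|[|n]].
  - have -> : Posz n + 1 = Posz n.+1 :> int by rewrite -PoszD addn1.
    exact: VS.
  - have -> : Negz 0 + 1 = Posz 0 :> int by [].
    by rewrite /= V0 -U0; apply: US.
  have -> : Negz n.+1 + 1 = Negz n :> int.
    by rewrite !NegzE -[n.+2]addn1 PoszD opprD subrK.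
  exact: US.
have WP (k : int) : {W : {P : lmodType R &
      ({linear Z (k + 1)%R -> P} * {linear P -> Z k})%type}
    | [/\ projective (projT1 W), ses (projT2 W).1 (projT2 W).2 &
      forall Q, projective Q -> extends_along Q (projT2 W).1]}.
  by apply: cid; have [P [i [p H]]] := ZS k; exists (existT _ P (i, p)).
pose W (k : int) := sval (WP k).
pose i k := (projT2 (W k)).1; pose p k := (projT2 (W k)).2.
have prW k : projective (projT1 (W k)) by case: (svalP (WP k)).
have iI k : injective (i k) by case: (svalP (WP k)) => _ [].
have ex k : exact_at (i k) (p k) by case: (svalP (WP k)) => _ [].
have ps k : surj (p k) by case: (svalP (WP k)) => _ [].
have iQ k Q : projective Q -> extends_along Q (i k).
  by case: (svalP (WP k)) => _ _; apply.
exists (fun k => projT1 (W k)), (fun k => i k \o p (k + 1)); split=> //.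
- move=> k y /=; split=> [/(inj_eq0 (@iI k))/ex[z <-]|[x <-]].
    by have [x <-] := ps _ z; exists x.
  by rewrite /= (exact_comp _ (@ex _)) linear0.
- move=> Q prQ k u; split=> [ud|[v vE] x]; last first.
    by rewrite -vE /= (exact_comp _ (@ex _)) !linear0.
  have [|w wE] := @factor_surj _ _ _ _ (p (k + 1)) u (@ps _).
    by move=> x /ex[z <-]; have [y <-] := ps _ z; apply: ud.
  by have [v vE] := iQ k Q prQ w; exists v => y; rewrite /= vE wE.
have [k [j jb]] : exists k, isomorphic M (Z (k + 1)).
  exists (Negz 0); have -> : Negz 0 + 1 = Posz 0 :> int by [].
  by rewrite /= V0; exists idfun, id.
exists k, (i k \o j); split=> [|y]; first exact: inj_comp (bij_inj jb).
case: jb => j' jK Kj; split=> [] [x <-].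
  by have [z zE] := ps _ (j x); exists z; rewrite /= zE.
by exists (j' (p (k + 1) x)); rewrite /= Kj.
Qed.

Lemma gorenstein_projective_up M : gorenstein_projective M ->
  exists2 N, gorenstein_projective N & acyclic_step M N.
Proof.
move=> [P [d [prP ex exQ [k [j [jI jE]]]]]].
have [l kE] : exists l, k = l + 1 by exists (k - 1); rewrite subrK.
rewrite {}kE in j jI jE.
have [N [i [iI iE]]] := submodule_exists (submod_im (d l)).
have [|p pE] := @factor_inj _ _ _ _ i (d l) iI.
  by move=> x; apply/iE; exists x.
exists N; first by exists P, d; split=> //; exists l, i; split=> // y; rewrite -iE.
exists (P (l + 1)), j, p; split=> //.
  split=> // [y|y].
    rewrite jE -ex -pE; split=> [->|/(inj_eq0 iI)//]; exact: linear0.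
  have /iE[x xE] : exists u, i u = i y by exists y.
  by exists x; apply: iI; rewrite pE.
move=> Q prQ u.
have [q qE] : exists q : {linear P (l + 1 + 1) -> M}, forall x, j (q x) = d (l + 1) x.
  by apply: factor_inj jI _ => x; apply/jE; exists x.
have [v vE] : exists v : {linear P (l + 1) -> Q}, forall y, v (d (l + 1) y) = (u \o q) y.
  apply/exQ => // x /=; rewrite (_ : q _ = 0) ?linear0 //.
  by apply: jI; rewrite qE linear0; apply/ex; exists x.
exists v => x; have /jE[y yE] : exists z, j z = j x by exists x.
by rewrite -yE vE /=; congr (u _); apply: jI; rewrite qE.
Qed.

Lemma gorenstein_projective_down M : gorenstein_projective M ->
  exists2 N, gorenstein_projective N & acyclic_step N M.
Proof.
move=> [P [d [prP ex exQ [k [j [jI jE]]]]]].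
have [N [i [iI iE]]] := submodule_exists (submod_im (d (k + 1))).
have [p pE] : exists p : {linear P (k + 1) -> M}, forall x, j (p x) = d k x.
  by apply: factor_inj jI _ => x; apply/jE; exists x.
exists N; first by exists P, d; split=> //; exists (k + 1), i; split=> // y; rewrite -iE.
exists (P (k + 1)), i, p; split=> //.
  split=> // [y|y].
    rewrite -iE /= -ex -pE; split=> [->|/(inj_eq0 jI)//]; exact: linear0.
  have /jE[x xE] : exists u, j u = j y by exists y.
  by exists x; apply: jI; rewrite pE.
move=> Q prQ u.
have [q qE] : exists q : {linear P (k + 1 + 1) -> N}, forall x, i (q x) = d (k + 1) x.
  by apply: factor_inj iI _ => x; apply/iE; exists x.
have [v vE] : exists v : {linear P (k + 1) -> Q}, forall y, v (d (k + 1) y) = (u \o q) y.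
  apply/exQ => // x /=; rewrite (_ : q _ = 0) ?linear0 //.
  by apply: iI; rewrite qE linear0; apply/ex; exists x.
exists v => x; have /iE[y yE] : exists z, i z = i x by exists x.
by rewrite -yE vE /=; congr (u _); apply: iI; rewrite qE.
Qed.

(** This is the vanishing of Ext^1(N, Q) in Yoneda's form.  By projectivity
    [P] maps to [X] over [N], and then [X] is a quotient of [K' * P], on which
    the extension can be defined. *)
Lemma extends_along_any K P N (i : {linear K -> P}) (p : {linear P -> N}) Q :
  projective P -> ses i p -> extends_along Q i ->
  forall K' X (i' : {linear K' -> X}) (p' : {linear X -> N}),
    ses i' p' -> extends_along Q i'.
Proof.
move=> prP [iI ex ps] iQ K' X i' p' [i'I ex' p's] u.
have [f fE] := prP _ _ p' p p's.
have [g gE] : exists g : {linear K -> K'}, forall k, i' (g k) = (f \o i) k.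
  by apply: factor_inj i'I _ => k; apply/ex'; rewrite /= fE (exact_comp _ ex).
have [w wE] := iQ (u \o g).
have [||v vE] := @factor_surj _ _ _ _ (copair_map i' f) (copair_map u w).
- move=> x; have [y yE] := ps (p' x).
  have /ex'[k kE] : p' (x - f y) = 0 by rewrite linearB fE yE subrr.
  by exists (k, y); rewrite /= kE subrK.
- move=> [k y] /= E; have py : p y = 0.
    by have := congr1 p' E; rewrite linearD (exact_comp _ ex') add0r fE linear0.
  have /ex[z zE] := py; move: E; rewrite -zE wE /=.
  have /= <- := gE z; rewrite -linearD => /(inj_eq0 i'I) /(congr1 u).
  by rewrite linearD linear0.
by exists v => k; have := vE (k, 0); rewrite /= !linear0 !addr0.
Qed.

(** The extension closure of the retracts of Gorenstein projective modules.
    The complement of a retract enters the cosyzygies of that retract, which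
    is why the class has to be closed under extensions. *)
Inductive gorenstein_closure : lmodType R -> Prop :=
| Closure_retract A M of retract A M & gorenstein_projective M : gorenstein_closure A
| Closure_ext X Y Z (i : {linear X -> Y}) (p : {linear Y -> Z}) of
    ses i p & gorenstein_closure X & gorenstein_closure Z : gorenstein_closure Y.

Lemma gorenstein_closure_extends N : gorenstein_closure N ->
  forall Q, projective Q -> forall K X (i : {linear K -> X}) (p : {linear X -> N}),
    ses i p -> extends_along Q i.
Proof.
elim=> {N} [A M AM /gorenstein_projective_down[M' _ [P [i [p [prP sip iQ]]]]] Q prQ|].
  have [K' [P' [i' [p' [_ prP' sip' iQ']]]]] :=
    stable_retract_syzygy (retract_stable AM) prP sip.
  move=> K X j q; apply: (extends_along_any prP' sip').
  exact/iQ'/iQ.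
move=> X Y Z i p [iI ex ps] _ EX _ EZ Q prQ K E j q [jI exj qs] u.
(* [E1], the preimage of [X], is an extension of [X] by [K]. *)
have [E1 [e [eI eE]]] := submodule_exists (submod_ker (p \o q)).
have [q1 q1E] : exists q1 : {linear E1 -> X}, forall x, i (q1 x) = (q \o e) x.
  by apply: factor_inj iI _ => x; apply/ex/eE; exists x.
have [j1 j1E] : exists j1 : {linear K -> E1}, forall x, e (j1 x) = j x.
  by apply: factor_inj eI _ => x; apply/eE; rewrite /= (exact_comp _ exj) linear0.
have [|v vE] := EX Q prQ _ _ j1 q1 _ u.
  split=> [x y /(congr1 e)|y|y].
  - by rewrite !j1E => /jI.
  - split=> [qy|[x <-]].
      have /exj[x xE] : q (e y) = 0 by have := q1E y; rewrite qy linear0 /= => <-.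
      by exists x; apply: eI; rewrite j1E.
    by apply: iI; rewrite q1E /= j1E (exact_comp _ exj) linear0.
  have [x xE] := qs (i y).
  have /eE[z zE] : (p \o q) x = 0 by rewrite /= xE (exact_comp _ ex).
  by exists z; apply: iI; rewrite q1E /= zE.
have [|w wE] := EZ Q prQ _ _ e (p \o q) _ v.
  split=> // y; have [x <-] := ps y; have [z <-] := qs x; by exists z.
by exists w => x; rewrite -vE -wE j1E.
Qed.

Lemma gorenstein_closure_step K P N (i : {linear K -> P}) (p : {linear P -> N}) :
  gorenstein_closure N -> projective P -> ses i p -> acyclic_step K N.
Proof.
move=> cN prP sip; exists P, i, p; split=> // Q prQ.
exact: gorenstein_closure_extends cN _ prQ _ _ _ _ sip.
Qed.

(** For a retract [A] of [M] with complement [B], the kernel of [P -> M -> A] is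
    an extension of [B] by the syzygy of [M]; for extensions this is the
    horseshoe construction. *)
Lemma gorenstein_closure_down N : gorenstein_closure N ->
  exists2 K, gorenstein_closure K & acyclic_step K N.
Proof.
move=> cN; suff [K cK [P [i [p [prP sip]]]]] :
    exists2 K, gorenstein_closure K & syzygy K N.
  by exists K => //; apply: gorenstein_closure_step cN prP sip.
elim: N / cN => [A M [s [r rs]] GM|X Y Z i p [iI ex ps] _ [K1 cK1 s1] _ [K2 cK2 s2]].
  have [M' GM' [P [i [p [prP [iI ex ps] _]]]]] := gorenstein_projective_down GM.
  have [B [j [q [qj sj]]]] := retract_compl rs.
  have [K [ka [kI kE]]] := submodule_exists (submod_ker (r \o p)).
  have [i1 i1E] : exists i1 : {linear M' -> K}, forall x, ka (i1 x) = i x.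
    by apply: factor_inj kI _ => x; apply/kE; rewrite /= (exact_comp _ ex) linear0.
  have cM' : gorenstein_closure M' := Closure_retract (retract_refl M') GM'.
  have cB : gorenstein_closure B by apply: Closure_retract GM; exists j, q.
  exists K.
    apply: (Closure_ext (i := i1) (p := q \o (p \o ka))) cM' cB; split.
    - by move=> x y /(congr1 ka); rewrite !i1E => /iI.
    - move=> y; split=> /= [qy|[x <-]]; last by rewrite i1E (exact_comp _ ex) linear0.
      have ry : (r \o p) (ka y) = 0 by apply/kE; exists y.
      have /ex[x xE] : p (ka y) = 0.
        by rewrite (sj (p (ka y))) qy -[r _]/((r \o p) (ka y)) ry !linear0 addr0.
      by exists x; apply: kI; rewrite i1E.
    move=> b; have [x xE] := ps (j b).
    have /kE[z zE] : (r \o p) x = 0.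
      rewrite /= xE; have := congr1 r (sj (j b)); rewrite linearD rs qj.
      by move=> /esym/(canRL (addrK _)); rewrite subrr.
    by exists z; rewrite /= zE xE qj.
  exists P, ka, (r \o p); split=> //; split=> // y.
  by have [x xE] := ps (s y); exists x; rewrite /= xE rs.
have [P1 [i1 [p1 [pr1 [i1I ex1 p1s]]]]] := s1.
have [P2 [i2 [p2 [pr2 [i2I ex2 p2s]]]]] := s2.
have [l lE] := pr2 _ _ p p2 ps.
pose P := (P1 * P2)%type.
have [f fE] : exists f : {linear P -> Y}, forall x, f x = i (p1 x.1) + l x.2.
  by exists (copair_map (i \o p1) l).
have [K [ka [kI kE]]] := submodule_exists (submod_ker f).
have [j jE] : exists j : {linear K1 -> K}, forall x, ka (j x) = (pair_map i1 \0) x.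
  apply: factor_inj kI _ => x; apply/kE.
  by rewrite /= fE /= (exact_comp _ ex1) !linear0 addr0.
have [q qE] : exists q : {linear K -> K2}, forall x, i2 (q x) = (snd \o ka) x.
  apply: factor_inj i2I _ => x; apply/ex2.
  have : f (ka x) = 0 by apply/kE; exists x.
  by move=> /(congr1 p); rewrite fE linearD (exact_comp _ ex) add0r lE linear0.
exists K.
  apply: (Closure_ext (i := j) (p := q)) cK1 cK2; split.
  - by move=> x y /(congr1 ka); rewrite !jE => -[/i1I].
  - move=> y; split=> [qy|[x <-]]; last by apply: i2I; rewrite qE /= jE linear0.
    have k2 : (ka y).2 = 0 by have := qE y; rewrite qy linear0 /=.
    have : f (ka y) = 0 by apply/kE; exists y.
    rewrite fE k2 linear0 addr0 => /(inj_eq0 iI)/ex1[x xE].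
    by exists x; apply: kI; rewrite jE /= xE -k2; case: (ka y).
  move=> k; have /ex[x xE] : p (l (i2 k)) = 0 by rewrite lE (exact_comp _ ex2).
  have [x1 x1E] := p1s (- x).
  have /kE[z zE] : f (x1, i2 k) = 0 by rewrite fE /= x1E linearN xE addNr.
  by exists z; apply: i2I; rewrite qE /= zE.
exists P, ka, f; split; first exact: proj_prod.
split=> // y; have [x2 x2E] := p2s (p y).
have /ex[x xE] : p (y - l x2) = 0 by rewrite linearB lE x2E subrr.
by have [x1 x1E] := p1s x; exists (x1, x2); rewrite fE /= x1E xE subrK.
Qed.

(** Dually to [gorenstein_closure_down].  The horseshoe construction needs the
    embedding of [X] to extend to [Y], which [gorenstein_closure_extends]
    provides. *)
Lemma gorenstein_closure_up N : gorenstein_closure N ->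
  exists2 C, gorenstein_closure C & acyclic_step N C.
Proof.
move=> cN; suff [C cC [P [i [p [prP sip]]]]] :
    exists2 C, gorenstein_closure C & syzygy N C.
  by exists C => //; apply: gorenstein_closure_step cC prP sip.
elim: N / cN => [A M [s [r rs]] GM|X Y Z i p sip _ [C1 cC1 s1] cZ [C2 cC2 s2]].
  have [M' GM' [P [i [p [prP [iI ex ps] _]]]]] := gorenstein_projective_up GM.
  have [B [j [q [qj sj]]]] := retract_compl rs.
  have sI : injective s by apply: can_inj rs.
  have [C [c [cs cE]]] := quotient_exists (submod_im (i \o s)).
  have [p1 p1E] : exists p1 : {linear C -> M'}, forall x, p1 (c x) = p x.
    by apply: factor_surj cs _ => x /cE[y <-]; apply: exact_comp ex.
  have cM' : gorenstein_closure M' := Closure_retract (retract_refl M') GM'.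
  have cB : gorenstein_closure B by apply: Closure_retract GM; exists j, q.
  have qs x : q (s x) = 0.
    have := congr1 q (sj (s x)); rewrite linearD qj rs.
    by move=> /esym/(canRL (addrK _)); rewrite subrr.
  exists C.
    apply: (Closure_ext (i := c \o (i \o j)) (p := p1)) cB cM'; split.
    - apply: linear_inj => b /cE[y /= /iI sy].
      by rewrite -(qj b) -sy qs.
    - move=> y; split=> [|[b <-]]; last by rewrite /= p1E (exact_comp _ ex).
      have [x <-] := cs y; rewrite p1E => /ex[m <-].
      exists (q m); apply/eqP; rewrite -subr_eq0 /= -linearB; apply/eqP/cE.
      exists (- r m); have /= -> := congr1 i (sj m).
      by rewrite /= linearN linearD linearN opprD addrCA subrr addr0.
    by move=> y; have [x <-] := ps y; exists (c x).
  exists P, (i \o s), c; split; first exact: prP.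
  by split; [exact: inj_comp | move=> y; apply: cE | exact: cs].
have [P1 [i1 [p1 [pr1 [i1I ex1 p1s]]]]] := s1.
have [P2 [i2 [p2 [pr2 [i2I ex2 p2s]]]]] := s2.
have [e eE] := gorenstein_closure_extends cZ pr1 sip i1.
case: sip => iI ex ps.
pose P := (P1 * P2)%type.
have [j jE] : exists j : {linear Y -> P}, forall y, j y = (e y, i2 (p y)).
  by exists (pair_map e (i2 \o p)).
have jI : injective j.
  apply: linear_inj => y; rewrite jE => -[ey /(inj_eq0 i2I)/ex[x xE]].
  by move: ey; rewrite -xE eE => /(inj_eq0 i1I) ->; rewrite linear0.
have [C [c [cs cE]]] := quotient_exists (submod_im j).
have [j1 j1E] : exists j1 : {linear C1 -> C},
    forall x, j1 (p1 x) = (c \o pair_map idfun \0) x.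
  apply: factor_surj p1s _ => y /ex1[x <-]; apply/cE; exists (i x).
  by rewrite jE eE (exact_comp _ ex) linear0.
have [q qE] : exists q : {linear C -> C2}, forall x, q (c x) = (p2 \o snd) x.
  by apply: factor_surj cs _ => x /cE[y <-]; rewrite jE /= (exact_comp _ ex2).
exists C.
  apply: (Closure_ext (i := j1) (p := q)) cC1 cC2; split.
  - apply: linear_inj => y; have [x <-] := p1s y; rewrite j1E /= => /cE[z].
    rewrite jE => -[<- /(inj_eq0 i2I)/ex[w <-]].
    by rewrite eE (exact_comp _ ex1).
  - move=> y; have [[x1 x2] <-] := cs y; rewrite qE /=; split=> [/ex2[z zE]|[w wE]].
      have [y' y'E] := ps z; exists (p1 (x1 - e y')); rewrite j1E /=.
      apply/eqP; rewrite -subr_eq0 -linearB; apply/eqP/cE; exists (- y').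
      rewrite linearN jE y'E zE.
      by congr pair; rewrite /= ?sub0r // addrAC subrr sub0r.
    have [w' w'E] := p1s w; have := congr1 q wE.
    by rewrite -w'E j1E !qE /= linear0 => <-.
  by move=> y; have [x2 <-] := p2s y; exists (c (0, x2)); rewrite qE.
by exists P, j, c; split; [exact: proj_prod | split=> // y; apply: cE].
Qed.

Lemma gorenstein_projective_retract A M :
  retract A M -> gorenstein_projective M -> gorenstein_projective A.
Proof.
move=> AM GM; apply: gorenstein_projective_coind gorenstein_closure_up
  gorenstein_closure_down _ (Closure_retract AM GM).
Qed.

End Gorenstein.

(** * Frobenius extensions *)

(** A Frobenius extension of [A] by [B], given by its Frobenius homomorphism
    [fe_tr] and a pair of dual bases.  The axioms are symmetric under passage
    to the opposite rings, so that one construction of induced modules serves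
    for left and for right modules. *)
Record frobenius_ext (A B : pzRingType) := FrobeniusExt {
  fe_inc : A -> B;
  fe_tr : B -> A;
  fe_I : finType;
  fe_x : fe_I -> B;
  fe_y : fe_I -> B;
  fe_incD : {morph fe_inc : a b / a + b};
  fe_incM : {morph fe_inc : a b / a * b};
  fe_inc1 : fe_inc 1 = 1;
  fe_trD : {morph fe_tr : b c / b + c};
  fe_trl : forall a b, fe_tr (fe_inc a * b) = a * fe_tr b;
  fe_trr : forall a b, fe_tr (b * fe_inc a) = fe_tr b * a;
  fe_dualx : forall b, b = \sum_i fe_x i * fe_inc (fe_tr (fe_y i * b));
  fe_dualy : forall b, b = \sum_i fe_inc (fe_tr (b * fe_x i)) * fe_y i
}.

Definition frobenius_op A B (f : frobenius_ext A B) : frobenius_ext A^c B^c :=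
  @FrobeniusExt A^c B^c (fe_inc f) (fe_tr f) (fe_I f) (@fe_y _ _ f) (@fe_x _ _ f)
    (@fe_incD _ _ f) (fun a b => @fe_incM _ _ f b a) (@fe_inc1 _ _ f) (@fe_trD _ _ f)
    (fun a b => @fe_trr _ _ f a b) (fun a b => @fe_trl _ _ f a b)
    (@fe_dualy _ _ f) (@fe_dualx _ _ f).

Definition res A B (f : frobenius_ext A B) (X : lmodType B) : Type := X.

Section Restriction.
Variables (A B : pzRingType) (f : frobenius_ext A B).
Local Notation inc := (fe_inc f).

Section OneModule.
Variable X : lmodType B.
HB.instance Definition _ := GRing.Zmodule.copy (res f X) X.

Definition res_scale (a : A) (x : res f X) : res f X := inc a *: (x : X).

Let resA a b x : res_scale a (res_scale b x) = res_scale (a * b) x.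
Proof. by rewrite /res_scale scalerA fe_incM. Qed.
Let res1 : left_id 1 res_scale.
Proof. by move=> x; rewrite /res_scale fe_inc1 scale1r. Qed.
Let resDr : right_distributive res_scale +%R.
Proof. by move=> a x y; apply: scalerDr. Qed.
Let resDl x : {morph res_scale^~ x : a b / a + b}.
Proof. by move=> a b; rewrite /res_scale fe_incD scalerDl. Qed.

HB.instance Definition _ :=
  GRing.Zmodule_isLmodule.Build A (res f X) resA res1 resDr resDl.

Lemma res_scaleE (a : A) (x : res f X) : a *: x = inc a *: (x : X) :> X.
Proof. by []. Qed.
End OneModule.

Lemma res_map_linear (X Y : lmodType B) (h : {linear X -> Y}) :
  linear (h : res f X -> res f Y).
Proof. by move=> a x y; rewrite !res_scaleE linearP. Qed.

Definition res_map (X Y : lmodType B) (h : {linear X -> Y}) :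
  {linear res f X -> res f Y} := mk_linear (res_map_linear h).

End Restriction.

Section Coinduction.
Variables (A B : pzRingType) (f : frobenius_ext A B).
Local Notation inc := (fe_inc f).
Local Notation tr := (fe_tr f).
Local Notation fx := (fe_x (f:=f)).
Local Notation fy := (fe_y (f:=f)).

Lemma fe_tr0 : tr 0 = 0.
Proof. by apply: (addrI (tr 0)); rewrite -fe_trD !addr0. Qed.

Lemma fe_inc0 : inc 0 = 0.
Proof. by apply: (addrI (inc 0)); rewrite -fe_incD !addr0. Qed.

Lemma fe_tr_sum (I : Type) (s : seq I) (F : I -> B) :
  tr (\sum_(i <- s) F i) = \sum_(i <- s) tr (F i).
Proof. exact: (big_morph _ (@fe_trD _ _ f) fe_tr0). Qed.

Lemma fe_inc_sum (I : Type) (s : seq I) (F : I -> A) :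
  inc (\sum_(i <- s) F i) = \sum_(i <- s) inc (F i).
Proof. exact: (big_morph _ (@fe_incD _ _ f) fe_inc0). Qed.

Section OneModule.
Variable M : lmodType A.

(** Hom_A(B, M), with [B] acting through right translations. *)
Definition coind : Type :=
  {u : B -> M | (forall b c, u (b + c) = u b + u c) /\
                (forall a b, u (inc a * b) = a *: u b)}.

Definition cof (u : coind) : B -> M := sval u.
Arguments cof : simpl never.

Lemma cofD u b c : cof u (b + c) = cof u b + cof u c.
Proof. by case: u => u [uD uZ]; apply: uD. Qed.

Lemma cofZ u a b : cof u (inc a * b) = a *: cof u b.
Proof. by case: u => u [uD uZ]; apply: uZ. Qed.

Lemma cof0 u : cof u 0 = 0.
Proof. by apply: (addrI (cof u 0)); rewrite -cofD !addr0. Qed.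

Lemma cof_sum u (I : Type) (s : seq I) (F : I -> B) :
  cof u (\sum_(i <- s) F i) = \sum_(i <- s) cof u (F i).
Proof. exact: (big_morph _ (cofD u) (cof0 u)). Qed.

Lemma coind_eq (u v : coind) : (forall b, cof u b = cof v b) -> u = v.
Proof.
case: u v => [u Hu] [v Hv] /= /funext uv; rewrite /cof /= in uv.
by case: _ / uv Hv => Hv; rewrite (Prop_irrelevance Hu Hv).
Qed.

Let coind0 : coind.
Proof. by exists (fun=> 0); split=> *; rewrite ?addr0 ?scaler0. Defined.
Let coindD (u v : coind) : coind.
Proof.
exists (fun b => cof u b + cof v b).
by split=> *; rewrite ?cofD ?cofZ ?scalerDr // addrACA.
Defined.
Let coindN (u : coind) : coind.
Proof.
exists (fun b => - cof u b).
by split=> *; rewrite ?cofD ?cofZ ?scalerN // opprD.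
Defined.
Let coindZ (c : B) (u : coind) : coind.
Proof.
exists (fun b => cof u (b * c)).
by split=> *; rewrite ?mulrDl ?cofD // -mulrA cofZ.
Defined.

Let coindA : associative coindD.
Proof. by move=> u v w; apply: coind_eq => b; apply: addrA. Qed.
Let coindC : commutative coindD.
Proof. by move=> u v; apply: coind_eq => b; apply: addrC. Qed.
Let coind0D : left_id coind0 coindD.
Proof. by move=> u; apply: coind_eq => b; apply: add0r. Qed.
Let coindND : left_inverse coind0 coindN coindD.
Proof. by move=> u; apply: coind_eq => b; apply: addNr. Qed.

HB.instance Definition _ := gen_eqMixin coind.
HB.instance Definition _ := gen_choiceMixin coind.
HB.instance Definition _ :=
  GRing.isZmodule.Build coind coindA coindC coind0D coindND.

Let coindZA (c d : B) u : coindZ c (coindZ d u) = coindZ (c * d) u.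
Proof. by apply: coind_eq => b; rewrite /cof /= mulrA. Qed.
Let coind1Z : left_id 1 coindZ.
Proof. by move=> u; apply: coind_eq => b; rewrite /cof /= mulr1. Qed.
Let coindZDr : right_distributive coindZ +%R.
Proof. by move=> c u v; apply: coind_eq. Qed.
Let coindZDl u : {morph coindZ^~ u : c d / c + d}.
Proof. by move=> c d; apply: coind_eq => b; rewrite [LHS]/cof /= mulrDr cofD. Qed.

HB.instance Definition _ :=
  GRing.Zmodule_isLmodule.Build B coind coindZA coind1Z coindZDr coindZDl.

Lemma cof_add (u v : coind) b : cof (u + v) b = cof u b + cof v b.
Proof. by []. Qed.
Lemma cof_scale (c : B) (u : coind) b : cof (c *: u) b = cof u (b * c).
Proof. by []. Qed.
Lemma cof_zero b : cof 0 b = 0.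
Proof. by []. Qed.
Lemma cof_big (I : Type) (s : seq I) (F : I -> coind) b :
  cof (\sum_(i <- s) F i) b = \sum_(i <- s) cof (F i) b.
Proof. by elim/big_rec2: _ => // i u v _ <-. Qed.

Let eta_fun (m : M) : coind.
Proof.
exists (fun b => tr b *: m).
by split=> *; rewrite ?fe_trD ?scalerDl // fe_trl scalerA.
Defined.

Lemma eta_linear : linear (eta_fun : M -> res f coind).
Proof.
move=> a m n; apply: coind_eq => b.
rewrite -[LHS]/(tr b *: (a *: m + n)) -[RHS]/(tr (b * inc a) *: m + tr b *: n).
by rewrite fe_trr -scalerA scalerDr.
Qed.

Definition eta : {linear M -> res f coind} := mk_linear eta_linear.

Lemma cof_eta m b : cof (eta m) b = tr b *: m.
Proof. by []. Qed.

Lemma coind_expand (u : coind) : u = \sum_i fx i *: (eta (cof u (fy i)) : coind).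
Proof.
apply: coind_eq => b; rewrite [in LHS](@fe_dualy _ _ f b) cof_sum cof_big.
by apply: eq_bigr => i _; rewrite cof_scale cof_eta cofZ.
Qed.

Lemma coind_map_expand (X : lmodType B) (h : {linear coind -> X}) u :
  h u = \sum_i fx i *: h (eta (cof u (fy i)) : coind).
Proof.
rewrite [in LHS](coind_expand u) linear_sum.
by apply: eq_bigr => i _; rewrite linearZZ.
Qed.

Lemma ev1_linear : linear (fun u : res f coind => cof u 1).
Proof.
move=> a u v; rewrite -[LHS]/(cof u (1 * inc a) + cof v 1).
by rewrite mul1r -[inc a]mulr1 cofZ.
Qed.

Definition ev1 : {linear res f coind -> M} := mk_linear ev1_linear.

End OneModule.

Arguments cof : simpl never.

(** The right adjoint of restriction: maps to [coind M] are determined by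
    their values at 1. *)
Section RightAdjoint.
Variables (X : lmodType B) (M : lmodType A) (w : {linear res f X -> M}).

Let corec_fun (x : X) : coind M.
Proof.
exists (fun b => w (b *: x : X)); split=> [b c|a b].
  by rewrite scalerDl -linearD.
by rewrite -scalerA -linearZZ.
Defined.

Lemma corec_linear : linear corec_fun.
Proof.
move=> c x y; apply: coind_eq => b; rewrite cof_add cof_scale /cof /=.
by rewrite scalerDr scalerA -linearD.
Qed.

Definition coind_corec : {linear X -> coind M} := mk_linear corec_linear.

Lemma cof_corec x b : cof (coind_corec x) b = w (b *: x : X).
Proof. by []. Qed.

End RightAdjoint.

(** The left adjoint of restriction: by [coind_expand] the image of [eta]
    generates [coind M], and the dual bases turn a map on it into one on all
    of [coind M]. *)
Section LeftAdjoint.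
Variables (X : lmodType B) (M : lmodType A) (v : {linear M -> res f X}).

Let rec_fun (u : coind M) : X := \sum_i fx i *: (v (cof u (fy i)) : X).

Lemma rec_linear : linear rec_fun.
Proof.
move=> c u u'; rewrite /rec_fun.
have -> : \sum_i fx i *: (v (cof (c *: u + u') (fy i)) : X) =
   \sum_i fx i *: (v (cof u (fy i * c)) : X) + rec_fun u'.
  rewrite -big_split; apply: eq_bigr => i _ /=.
  by rewrite cof_add cof_scale linearD scalerDr.
congr (_ + _); rewrite scaler_sumr.
transitivity (\sum_i \sum_j (fx i * inc (tr (fy i * (c * fx j)))) *:
    (v (cof u (fy j)) : X)).
  apply: eq_bigr => i _.
  rewrite {1}(@fe_dualy _ _ f (fy i * c)) cof_sum linear_sum scaler_sumr.
  apply: eq_bigr => j _; rewrite cofZ linearZZ res_scaleE scalerA.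
  by rewrite -mulrA.
rewrite exchange_big; apply: eq_bigr => j _.
by rewrite -scaler_suml -fe_dualx scalerA.
Qed.

Definition coind_rec : {linear coind M -> X} := mk_linear rec_linear.

Lemma coind_rec_eta m : coind_rec (eta M m) = v m.
Proof.
rewrite /= /rec_fun -[RHS](@scale1r B X) {1}(@fe_dualx _ _ f 1) scaler_suml.
apply: eq_bigr => i _.
by rewrite cof_eta linearZZ res_scaleE scalerA mulr1.
Qed.

End LeftAdjoint.

Section CoindMap.
Variables (M N : lmodType A) (h : {linear M -> N}).

Let map_fun (u : coind M) : coind N.
Proof.
exists (fun b => h (cof u b)).
by split=> *; rewrite ?cofD ?cofZ ?linearD ?linearZZ.
Defined.

Lemma coind_map_linear : linear map_fun.
Proof.
move=> c u v; apply: coind_eq => b.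
by rewrite cof_add cof_scale /cof /= -linearD.
Qed.

Definition coind_map : {linear coind M -> coind N} := mk_linear coind_map_linear.

Lemma cof_map u b : cof (coind_map u) b = h (cof u b).
Proof. by []. Qed.

Lemma coind_map_eta m : coind_map (eta M m) = eta N (h m).
Proof. by apply: coind_eq => b; rewrite cof_map !cof_eta linearZZ. Qed.

Lemma coind_map_inj : injective h -> injective coind_map.
Proof.
move=> hI u v uv; apply: coind_eq => b; apply: hI.
by rewrite -!cof_map uv.
Qed.

End CoindMap.

(** An element of [coind N] is built from its finitely many values at [fy i],
    which can be lifted separately. *)
Lemma coind_exact (M N K : lmodType A) (g : {linear M -> N}) (h : {linear N -> K}) :
  exact_at g h -> exact_at (coind_map g) (coind_map h).
Proof.
move=> ex u; split=> [hu|[v <-]]; last first.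
  by apply: coind_eq => b; rewrite !cof_map (exact_comp _ ex).
have /choice[m mE] i : exists m, g m = cof u (fy i).
  by apply/ex; rewrite -cof_map hu cof_zero.
exists (\sum_i fx i *: (eta M (m i) : coind M)).
rewrite linear_sum [RHS]coind_expand; apply: eq_bigr => i _.
by rewrite linearZZ coind_map_eta mE.
Qed.

Lemma coind_surj (M N : lmodType A) (g : {linear M -> N}) :
  surj g -> surj (coind_map g).
Proof.
move=> gs u; apply/(coind_exact (h := \0 : {linear N -> N})).
  by move=> y; split=> // _; apply: gs.
by apply: coind_eq => b; rewrite cof_map.
Qed.

Lemma coind_ses (K P N : lmodType A) (i : {linear K -> P}) (p : {linear P -> N}) :
  ses i p -> ses (coind_map i) (coind_map p).
Proof.
by case=> *; split; [apply: coind_map_inj | apply: coind_exact | apply: coind_surj].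
Qed.

Lemma res_ses (K P N : lmodType B) (i : {linear K -> P}) (p : {linear P -> N}) :
  ses i p -> ses (res_map f i) (res_map f p).
Proof. by []. Qed.

(** As left adjoints of exact functors, both functors preserve projectives. *)
Lemma coind_projective (P : lmodType A) : projective P -> projective (coind P).
Proof.
move=> prP C D p h ps.
have [l lE] := prP _ _ (res_map f p) (res_map f h \o eta P) ps.
exists (coind_rec l) => u; rewrite [RHS]coind_map_expand.
rewrite -[coind_rec l u]/(\sum_i fx i *: (l (cof u (fy i)) : C)) linear_sum.
by apply: eq_bigr => i _; rewrite linearZZ; congr (_ *: _); apply: lE.
Qed.

Lemma res_projective (P : lmodType B) : projective P -> projective (res f P).
Proof.
move=> prP C D p h ps.
have [l lE] := prP _ _ (coind_map p) (coind_corec h) (coind_surj ps).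
exists (ev1 C \o res_map f l) => x /=.
have := congr1 (fun u => cof u 1) (lE x).
by rewrite cof_map cof_corec scale1r.
Qed.

Lemma coind_extends (K P : lmodType A) (i : {linear K -> P}) (Q : lmodType B) :
  extends_along (res f Q) i -> extends_along Q (coind_map i).
Proof.
move=> iQ u; have [v vE] := iQ (res_map f u \o eta K).
exists (coind_rec v) => x; rewrite [RHS]coind_map_expand.
by apply: eq_bigr => j _; rewrite cof_map vE.
Qed.

Lemma res_extends (K P : lmodType B) (i : {linear K -> P}) (Q : lmodType A) :
  extends_along (coind Q) i -> extends_along Q (res_map f i).
Proof.
move=> iQ u; have [v vE] := iQ (coind_corec u).
exists (ev1 Q \o res_map f v) => x /=.
by rewrite vE cof_corec scale1r.
Qed.

(** Hom_A(X, A) and Hom_B(X, B) correspond to each other: composition with the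
    Frobenius homomorphism is inverted by [frobenius_lift]. *)
Lemma frobenius_lift_linear (X : lmodType B) (u : {linear res f X -> A^o}) :
  linear (fun x : X => \sum_i fx i * inc (u (fy i *: x : X)) : B^o).
Proof.
move=> c x y.
have -> : \sum_i fx i * inc (u (fy i *: (c *: x + y) : X)) =
   \sum_i fx i * inc (u ((fy i * c) *: x : X)) +
   \sum_i fx i * inc (u (fy i *: y : X)).
  rewrite -big_split; apply: eq_bigr => i _ /=.
  by rewrite scalerDr linearD scalerA fe_incD mulrDr.
congr (_ + _); rewrite [RHS]mulr_sumr.
transitivity (\sum_i \sum_j fx i * inc (tr (fy i * (c * fx j))) *
    inc (u (fy j *: x : X))).
  apply: eq_bigr => i _; rewrite {1}(@fe_dualy _ _ f (fy i * c)) scaler_suml.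
  rewrite linear_sum fe_inc_sum mulr_sumr; apply: eq_bigr => j _.
  rewrite -scalerA -res_scaleE linearZZ.
  by rewrite -[_ *: u _]/(_ * u _) fe_incM !mulrA.
rewrite exchange_big; apply: eq_bigr => j _.
by rewrite -mulr_suml -fe_dualx mulrA.
Qed.

Definition frobenius_lift (X : lmodType B) (u : {linear res f X -> A^o}) :
  {linear X -> B^o} := mk_linear (frobenius_lift_linear u).

Lemma frobenius_liftK (X : lmodType B) (u : {linear res f X -> A^o}) x :
  tr (frobenius_lift u x) = u x.
Proof.
rewrite /= fe_tr_sum.
under eq_bigr => i _ do rewrite fe_trr.
rewrite -[in RHS](@scale1r B X x) [in RHS](@fe_dualy _ _ f 1) scaler_suml linear_sum.
apply: eq_bigr => i _; rewrite -scalerA -res_scaleE linearZZ mul1r.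
by [].
Qed.

Lemma tr_comp_linear (X : lmodType B) (w : {linear X -> B^o}) :
  linear ((fun x => tr (w x)) : res f X -> A^o).
Proof. by move=> a x y; rewrite res_scaleE linearP fe_trD fe_trl. Qed.

Lemma frobenius_lift_tr (X : lmodType B) (w : {linear X -> B^o}) x :
  frobenius_lift (mk_linear (tr_comp_linear w)) x = w x.
Proof.
rewrite /= [RHS](@fe_dualx _ _ f (w x)); apply: eq_bigr => i _.
by rewrite linearZZ.
Qed.

Lemma res_extends_ring (K P : lmodType B) (i : {linear K -> P}) :
  extends_along B^o i -> extends_along A^o (res_map f i).
Proof.
move=> iQ u; have [v vE] := iQ (frobenius_lift u).
by exists (mk_linear (tr_comp_linear v)) => x /=; rewrite vE frobenius_liftK.
Qed.

(** By the dual bases, [B] is a retract of a finite power of [A] as an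
    [A]-module, so that maps to [res f B^o] extend coordinatewise. *)
Lemma coind_extends_ring (K P : lmodType A) (i : {linear K -> P}) :
  extends_along A^o i -> extends_along B^o (coind_map i).
Proof.
move=> iQ; apply: coind_extends => u.
have lu j : linear (fun k => tr ((u k : B) * fx j) : A^o).
  by move=> a k l; rewrite linearP mulrDl fe_trD -mulrA fe_trl.
have /choice[v vE] j := iQ (mk_linear (lu j)).
have lv : linear (fun x => \sum_j inc (v j x) * fy j : res f B^o).
  move=> a x y; rewrite -[RHS]/(inc a * (\sum_j inc (v j x) * fy j) +
    \sum_j inc (v j y) * fy j) mulr_sumr -big_split /=.
  by apply: eq_bigr => j _; rewrite linearP fe_incD fe_incM mulrDl mulrA.
exists (mk_linear lv) => k /=.
by rewrite [RHS](@fe_dualy _ _ f (u k)); apply: eq_bigr => j _; rewrite vE.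
Qed.

Lemma coind_fin_gen (M : lmodType A) : fin_gen M -> fin_gen (coind M).
Proof.
move=> [n [e eM]]; exists n, (fun j => eta M (e j) : coind M) => u.
have /choice[c cE] i := eM (cof u (fy i)).
exists (fun j => \sum_i fx i * inc (c i j)).
under [RHS]eq_bigr => j _ do rewrite scaler_suml.
rewrite exchange_big [LHS]coind_expand; apply: eq_bigr => i _.
rewrite cE linear_sum scaler_sumr; apply: eq_bigr => j _.
by rewrite linearZZ res_scaleE scalerA.
Qed.

Lemma res_fin_gen (X : lmodType B) : fin_gen X -> fin_gen (res f X).
Proof.
move=> [n [e eX]].
pose g (k : 'I_n * fe_I f) : res f X := (fy k.2 *: e k.1 : X).
apply: (@fin_genP A _ (res f X) g) => x.
have [c xE] := eX x; exists (fun k => tr (c k.1 * fx k.2)).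
rewrite -(pair_bigA _ (fun j i => (tr (c j * fx i)) *: g (j, i))) /=.
rewrite {1}xE; apply: eq_bigr => j _.
rewrite {1}(@fe_dualy _ _ f (c j)) scaler_suml; apply: eq_bigr => i _.
by rewrite res_scaleE scalerA.
Qed.

(** [B] is generated over [A] by the finitely many [fy i]. *)
Lemma frobenius_artinian : left_artinian A -> left_artinian B.
Proof.
move=> hA; have dB : dcc (res f B^o).
  apply: dcc_fin_gen hA _; apply: res_fin_gen.
  exists 1%N, (fun=> 1 : B^o) => b; exists (fun=> b).
  by rewrite big_ord1 -[RHS]/(b * 1) mulr1.
move=> N sN; apply: dB => n; have [N0 ND NZ] := sN n.
by split=> // a x Nx; apply: NZ.
Qed.

End Coinduction.

Arguments cof : simpl never.

(** * Transfer of torsionfree and Gorenstein projective modules *)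

Section ExtTransfer.
Variables (A B : pzRingType) (f : frobenius_ext A B).

Lemma coind_ext_zero n (N : lmodType A) :
  ext_zero n.+1 N A^o -> ext_zero n.+1 (coind f N : lmodType B) B^o.
Proof.
apply: (@ext_zero_simulation A B A^o B^o (fun N' N => N' = coind f N)) => //.
move=> _ {}N K P i p -> prP sip.
exists (coind f K), (coind f P), (coind_map f i), (coind_map f p).
by split; [| apply: coind_projective | apply: coind_ses | apply: coind_extends_ring].
Qed.

Lemma res_ext_zero n (N : lmodType B) :
  ext_zero n.+1 N B^o -> ext_zero n.+1 (res f N : lmodType A) A^o.
Proof.
apply: (@ext_zero_simulation B A B^o A^o (fun N' N => N' = res f N)) => //.
move=> _ {}N K P i p -> prP sip.
exists (res f K), (res f P), (res_map f i), (res_map f p).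
by split; [| apply: res_projective | apply: res_ses | apply: res_extends_ring].
Qed.

End ExtTransfer.

Section Transfer.
Variables (A B : pzRingType) (f : frobenius_ext A B).
Local Notation inc := (fe_inc f).
Local Notation tr := (fe_tr f).
Local Notation fx := (fe_x (f:=f)).
Local Notation fy := (fe_y (f:=f)).
Local Notation fop := (frobenius_op f).

Lemma coind_gorenstein_projective (M : lmodType A) :
  gorenstein_projective M -> gorenstein_projective (coind f M).
Proof.
have step (X Y : lmodType A) : acyclic_step X Y -> acyclic_step (coind f X) (coind f Y).
  move=> [P [i [p [prP sip iQ]]]].
  exists (coind f P), (coind_map f i), (coind_map f p).
  split; [exact: coind_projective | exact: coind_ses |].
  by move=> Q prQ; apply/coind_extends/iQ/res_projective.
move=> GM; apply: (@gorenstein_projective_coind _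
  (fun N => exists2 M, gorenstein_projective M & N = coind f M)); last by exists M.
  move=> _ [X /gorenstein_projective_up[Y GY XY] ->].
  by exists (coind f Y); [exists Y | apply: step].
move=> _ [X /gorenstein_projective_down[Y GY XY] ->].
by exists (coind f Y); [exists Y | apply: step].
Qed.

Lemma res_gorenstein_projective (M : lmodType B) :
  gorenstein_projective M -> gorenstein_projective (res f M).
Proof.
have step (X Y : lmodType B) : acyclic_step X Y -> acyclic_step (res f X) (res f Y).
  move=> [P [i [p [prP sip iQ]]]].
  exists (res f P), (res_map f i), (res_map f p).
  split; [exact: res_projective | exact: res_ses |].
  by move=> Q prQ; apply/res_extends/iQ/coind_projective.
move=> GM; apply: (@gorenstein_projective_coind _
  (fun N => exists2 M, gorenstein_projective M & N = res f M)); last by exists M.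
  move=> _ [X /gorenstein_projective_up[Y GY XY] ->].
  by exists (res f Y); [exists Y | apply: step].
move=> _ [X /gorenstein_projective_down[Y GY XY] ->].
by exists (res f Y); [exists Y | apply: step].
Qed.

(** [frobenius_lift] identifies the two duals compatibly with the right
    actions, because in its definition the values of [u] stand on the right. *)
Lemma dual_res_linear (P : lmodType B) :
  linear (fun u : dual (res f P : lmodType A) =>
    (frobenius_lift u : dual P) : res fop (dual P)).
Proof.
move=> a u v; apply: dualP => x /=.
rewrite -[RHS]/(_ * inc a + _) mulr_suml -big_split /=.
by apply: eq_bigr => i _; rewrite fe_incD fe_incM mulrDr mulrA.
Qed.

Definition dual_res (P : lmodType B) :
  {linear dual (res f P : lmodType A) -> res fop (dual P)} :=
  mk_linear (@dual_res_linear P).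

Lemma dual_res_inj P : injective (@dual_res P).
Proof.
move=> u v uv; apply: dualP => x.
rewrite -(frobenius_liftK u) -(frobenius_liftK v).
by have /= -> := congr1 (fun w : dual P => w x) uv.
Qed.

Lemma dual_res_surj P : surj (@dual_res P).
Proof.
move=> w; exists (mk_linear (@tr_comp_linear _ _ f _ w) : dual (res f P : lmodType A)).
by apply: dualP => x; apply: frobenius_lift_tr.
Qed.

Lemma res_transpose (M : lmodType B) (N : lmodType B^c) :
  is_transpose M N -> is_transpose (res f M : lmodType A) (res fop N).
Proof.
move=> [P1 [P0 [g [p [q [[fg1 pr1] [fg0 pr0] [ex ps] [exq qs]]]]]]].
exists (res f P1), (res f P0), (res_map f g), (res_map f p).
exists (res_map fop q \o @dual_res P1).
split; [by split; [exact: res_fin_gen | exact: res_projective]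
       |by split; [exact: res_fin_gen | exact: res_projective]| by [] |].
have nat (u : dual (res f P0 : lmodType A)) :
    dual_res P1 (dual_map (res_map f g) u) = dual_map g (dual_res P0 u).
  apply: dualP => x /=; apply: eq_bigr => i _.
  by rewrite -linearZZ.
split=> [w|y]; last first.
  have [z zE] := qs y; have [u uE] := dual_res_surj z; exists u.
  by rewrite -[LHS]/(q (dual_res P1 u)) uE.
split=> [/exq[z zE]|[u <-]].
  have [u uE] := dual_res_surj z; exists u; apply: dual_res_inj.
  by rewrite nat uE.
by apply/exq; exists (dual_res P0 u); rewrite -nat.
Qed.

(** A functional [w] on [coind f P] is determined by its restriction to [P]
    along [eta], a [B]-valued map; the Frobenius homomorphism records the
    latter as a function from [B] to the [A]-valued functionals on [P]. *)
Lemma dual_coind_subproof (P : lmodType A) (w : dual (coind f P)) (b : B) :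
  linear (fun m : P => tr ((w (eta f P m) : B) * b) : A^o).
Proof.
move=> a m n; rewrite linearD linearZZ res_scaleE linearD linearZZ.
by rewrite mulrDl fe_trD -mulrA fe_trl.
Qed.

Definition dual_coind_fun (P : lmodType A) (w : dual (coind f P)) :
  coind fop (dual P).
Proof.
exists (fun b => mk_dual (dual_coind_subproof w b)).
split=> [b c|a b]; apply: dualP => m /=; first by rewrite mulrDr fe_trD.
exact: etrans (congr1 tr (mulrA (w (eta f P m) : B) b (inc a))) (fe_trr f a _).
Defined.

Lemma cof_dual_coind (P : lmodType A) (w : dual (coind f P)) b m :
  cof (dual_coind_fun w) b m = tr ((w (eta f P m) : B) * b).
Proof. by []. Qed.

Lemma dual_coind_linear (P : lmodType A) :
  linear (@dual_coind_fun P : dual (coind f P) -> coind fop (dual P)).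
Proof.
move=> c u v; apply: coind_eq => b; apply: dualP => m.
rewrite cof_dual_coind cof_add cof_scale.
by rewrite -[RHS]/(tr _ + tr _) -fe_trD /= mulrDl -mulrA.
Qed.

Definition dual_coind (P : lmodType A) :
  {linear dual (coind f P) -> coind fop (dual P)} :=
  mk_linear (@dual_coind_linear P).

Lemma dual_coind_inj P : injective (@dual_coind P).
Proof.
apply: linear_inj => w w0; apply: dualP => u.
rewrite [LHS]coind_map_expand big1 // => i _.
rewrite (@fe_dualy _ _ f (w _)) big1 ?scaler0 // => j _.
have -> : tr ((w (eta f P (cof u (fy i))) : B) * fx j) = 0.
  exact: (congr1 (fun v : coind fop (dual P) =>
    (cof v (fx j) : dual P) (cof u (fy i))) w0).
by rewrite fe_inc0 mul0r.
Qed.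

Lemma dual_coind_surj P : surj (@dual_coind P).
Proof.
move=> phi.
have lv : linear (fun m : P => \sum_i inc (cof phi (fx i) m) * fy i : res f B^o).
  move=> a m n; rewrite -[RHS]/(inc a * (\sum_i inc (cof phi (fx i) m) * fy i) +
    \sum_i inc (cof phi (fx i) n) * fy i) mulr_sumr -big_split /=.
  by apply: eq_bigr => j _; rewrite linearP fe_incD fe_incM mulrDl mulrA.
exists (coind_rec (mk_linear lv) : dual (coind f P)).
apply: coind_eq => b; apply: dualP => m.
rewrite cof_dual_coind coind_rec_eta /= mulr_suml fe_tr_sum.
rewrite [in RHS](@fe_dualx _ _ f b) cof_sum dual_sum_apply.
apply: eq_bigr => i _; rewrite -mulrA fe_trl.
exact: esym (congr1 (fun u : dual P => u m) (cofZ phi (tr (fy i * b)) (fx i))).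
Qed.

Lemma coind_transpose (M : lmodType A) (N : lmodType A^c) :
  is_transpose M N -> is_transpose (coind f M : lmodType B) (coind fop N).
Proof.
move=> [P1 [P0 [g [p [q [[fg1 pr1] [fg0 pr0] [ex ps] [exq qs]]]]]]].
exists (coind f P1), (coind f P0), (coind_map f g), (coind_map f p).
exists (coind_map fop q \o @dual_coind P1).
split; [by split; [exact: coind_fin_gen | exact: coind_projective]
       |by split; [exact: coind_fin_gen | exact: coind_projective]
       |by split; [exact: coind_exact | exact: coind_surj] |].
have nat (u : dual (coind f P0)) : dual_coind P1 (dual_map (coind_map f g) u) =
    coind_map fop (dual_map g) (dual_coind P0 u).
  apply: coind_eq => b; apply: dualP => m.
  by rewrite -[LHS]/(tr ((u (coind_map f g (eta f P1 m)) : B) * b)) coind_map_eta.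
have exc := @coind_exact _ _ fop _ _ _ _ _ exq.
split=> [w|y]; last first.
  have [z zE] := @coind_surj _ _ fop _ _ _ qs y; have [u uE] := dual_coind_surj z.
  by exists u; rewrite -[LHS]/(coind_map fop q (dual_coind P1 u)) uE.
split=> [/exc[z zE]|[u <-]].
  have [u uE] := dual_coind_surj z; exists u; apply: dual_coind_inj.
  by rewrite nat uE.
by apply/exc; exists (dual_coind P0 u); rewrite -nat.
Qed.

Lemma coind_TF k (M : lmodType A) : TF k M -> TF k (coind f M : lmodType B).
Proof.
move=> [fgM [N [MN eN]]]; split; first exact: coind_fin_gen.
exists (coind fop N); split; first exact: coind_transpose.
move=> [//|i] ik.
exact: (@coind_ext_zero A^c B^c fop i N (eN _ ik)).
Qed.

Lemma res_TF k (M : lmodType B) : TF k M -> TF k (res f M : lmodType A).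
Proof.
move=> [fgM [N [MN eN]]]; split; first exact: res_fin_gen.
exists (res fop N); split; first exact: res_transpose.
move=> [//|i] ik.
exact: (@res_ext_zero A^c B^c fop i N (eN _ ik)).
Qed.

End Transfer.

(** * Finite representation type along split separable Frobenius extensions *)

Section FiniteType.
Variables (A B : pzRingType) (f : frobenius_ext A B).
Hypothesis tr1 : fe_tr f 1 = 1.
Hypothesis index_inv : invertible (\sum_i @fe_x _ _ f i * fe_y i).

Lemma retract_res_coind (M : lmodType A) : retract M (res f (coind f M)).
Proof. by exists (eta f M), (ev1 f M) => m /=; rewrite cof_eta tr1 scale1r. Qed.

(** The composite of unit and counit is the action of the index. *)
Lemma retract_coind_res (N : lmodType B) : retract N (coind f (res f N)).
Proof.
pose c := \sum_i @fe_x _ _ f i * fe_y i.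
pose s : {linear N -> coind f (res f N)} :=
  @coind_corec _ _ f N (res f N) idfun.
pose r : {linear coind f (res f N) -> N} :=
  @coind_rec _ _ f N (res f N) idfun.
have rsE x : r (s x) = c *: x.
  by rewrite scaler_suml; apply: eq_bigr => i _; rewrite -scalerA.
have [d [dc cd]] := index_inv.
have rsb : bijective (r \o s).
  exists (fun x => d *: x) => x.
    by rewrite -[LHS]/(d *: r (s x)) rsE scalerA dc scale1r.
  by rewrite [LHS]rsE scalerA cd scale1r.
have [g gK _] := bij_linear_inv rsb.
by exists s, (g \o r).
Qed.

Lemma frobenius_finite_rep_type (CA : lmodType A -> Prop) (CB : lmodType B -> Prop) :
  left_artinian A ->
  (forall M, CA M -> fin_gen M) -> (forall N, CB N -> fin_gen N) ->
  (forall X M, retract X M -> CA M -> CA X) ->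
  (forall X N, retract X N -> CB N -> CB X) ->
  (forall M, CA M -> CB (coind f M)) -> (forall N, CB N -> CA (res f N)) ->
  finite_rep_type CB <-> finite_rep_type CA.
Proof.
move=> hA fgA fgB CAr CBr CAB CBA; have hB := frobenius_artinian f hA.
split.
  apply: (@finite_rep_type_transfer B A CB CA
    (fun N => res f N) (fun M => coind f M)) => //.
  - by move=> M _; apply: retract_res_coind.
  - by move=> N; apply: res_fin_gen.
  - move=> X Y /iso_retract[s [r rs]].
    by exists (res_map f s), (res_map f r) => x; apply: rs.
  move=> N I X i p ip; exists (fun k => res_map f (i k)), (fun k => res_map f (p k)).
  by move=> x; apply: ip.
apply: (@finite_rep_type_transfer A B CA CB
  (fun M => coind f M) (fun N => res f N)) => //.
- by move=> N _; apply: retract_coind_res.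
- by move=> M; apply: coind_fin_gen.
- move=> X Y /iso_retract[s [r rs]].
  exists (coind_map f s), (coind_map f r) => u; apply: coind_eq => b.
  by rewrite !cof_map rs.
move=> M I X i p ip.
exists (fun k => coind_map f (i k)), (fun k => coind_map f (p k)) => u.
apply: coind_eq => b; rewrite cof_big [LHS]ip.
by apply: eq_bigr => k _; rewrite !cof_map.
Qed.

End FiniteType.

(** * Skew group rings as Frobenius extensions *)

Section SkewGroupRings.
Variables (L : pzRingType) (G : finGroupType) (a : ring_action L G).

Lemma skew_mulE (x y : skew_ring a) k :
  (x * y) k = \sum_(g : G) x g * a g (y (g^-1 * k)%g).
Proof. by rewrite [LHS]ffunE. Qed.

Lemma skew_sumE (I : Type) (s : seq I) (F : I -> skew_ring a) g :
  (\sum_(i <- s) F i : skew_ring a) g = \sum_(i <- s) F i g.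
Proof. by elim/big_rec2: _ => [|i u v _ <-]; rewrite ffunE. Qed.

Lemma skew_expand (x : skew_ring a) : x = \sum_(g : G) skew_single a (x g) g.
Proof.
apply/ffunP => k; rewrite skew_sumE (bigD1 k) //= big1 => [|g gk].
  by rewrite ffunE eqxx addr0.
by rewrite ffunE eq_sym (negPf gk).
Qed.

Lemma skew_singleD g : {morph (skew_single a)^~ g : l m / l + m}.
Proof. by move=> l m; apply/ffunP => k; rewrite !ffunE; case: eqP; rewrite ?addr0. Qed.

Lemma skew_single1 : skew_single a 1 1%g = 1.
Proof. by []. Qed.

Let sinc (l : L) : skew_ring a := skew_single a l 1%g.
Let str (x : skew_ring a) : L := x 1%g.
Let sx (g : G) : skew_ring a := skew_single a 1 g^-1%g.
Let sy (g : G) : skew_ring a := skew_single a 1 g.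

Let sincM : {morph sinc : l m / l * m}.
Proof. by move=> l m; rewrite /sinc skew_singleM ract1 mulg1. Qed.

Let strD : {morph str : x y / x + y}.
Proof. by move=> x y; rewrite /str [LHS]ffunE. Qed.

Let single_mul_at l g (x : skew_ring a) k :
  (skew_single a l g * x) k = l * a g (x (g^-1 * k)%g).
Proof.
rewrite skew_mulE (bigD1 g) //= big1 => [|h hg]; rewrite ffunE ?eqxx ?addr0 //.
by rewrite (negPf hg) mul0r.
Qed.

Let mul_single_at l g (x : skew_ring a) k :
  (x * skew_single a l g) k = x (k * g^-1)%g * a (k * g^-1)%g l.
Proof.
rewrite skew_mulE (bigD1 (k * g^-1)%g) //= big1 => [|h hg].
  by rewrite ffunE invMg invgK mulgKV eqxx addr0.
rewrite ffunE; case: eqP => [hk|_]; last by rewrite rmorph0 mulr0.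
by case/eqP: hg; rewrite -hk invMg invgK mulKVg.
Qed.

Let strl l x : str (sinc l * x) = l * str x.
Proof. by rewrite /str single_mul_at ract1 invg1 mulg1. Qed.

Let strr l x : str (x * sinc l) = str x * l.
Proof. by rewrite /str mul_single_at invg1 mulg1 ract1. Qed.

Let sdualx x : x = \sum_g sx g * sinc (str (sy g * x)).
Proof.
rewrite [LHS]skew_expand (reindex_inj invg_inj); apply: eq_bigr => g _.
rewrite /str single_mul_at mul1r mulg1 /sx /sinc skew_singleM mul1r mulg1.
by rewrite -ractM mulVg ract1.
Qed.

Let sdualy x : x = \sum_g sinc (str (x * sx g)) * sy g.
Proof.
rewrite [LHS]skew_expand; apply: eq_bigr => g _.
rewrite /str mul_single_at invgK mul1g rmorph1 mulr1 /sinc /sy skew_singleM.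
by rewrite rmorph1 mulr1 mul1g.
Qed.

(** The skew group ring is free over [L] on [G], and the coefficient at the
    unit pairs each group element with its inverse. *)
Definition skew_frobenius : frobenius_ext L (skew_ring a) :=
  FrobeniusExt (@skew_singleD 1%g) sincM skew_single1 strD strl strr sdualx sdualy.

Lemma skew_tr1 : fe_tr skew_frobenius 1 = 1.
Proof. by rewrite /= /str ffunE eqxx. Qed.

Lemma skew_index_inv : invertible (#|G|%:R : L) ->
  invertible (\sum_i @fe_x _ _ skew_frobenius i * fe_y i).
Proof.
have -> : \sum_i @fe_x _ _ skew_frobenius i * fe_y i = sinc #|G|%:R.
  transitivity (\sum_(g : G) (1 : skew_ring a)).
    apply: eq_bigr => g _.
    by rewrite /= /sx /sy skew_singleM rmorph1 mulr1 mulVg.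
  rewrite sumr_const; elim: #|_| => [|n IH].
    by rewrite mulr0n; apply/ffunP => g; rewrite !ffunE if_same.
  by rewrite mulrS IH -[1]skew_single1 -skew_singleD -mulrS.
move=> [n [nG Gn]]; exists (sinc n).
by rewrite -!sincM nG Gn.
Qed.

End SkewGroupRings.

Theorem corollary6p9 (L : pzRingType) (G : finGroupType) (a : ring_action L G)
    (hL : left_artinian L) (hG : invertible (#|G|%:R : L)) :
  (forall k : nat, (0 < k)%N ->
     (finite_rep_type (@TF (skew_ring a) k) <-> finite_rep_type (@TF L k))) /\
  (CM_finite (skew_ring a) <-> CM_finite L).
Proof.
have FRT := frobenius_finite_rep_type (skew_tr1 a) (skew_index_inv a hG).
split=> [k _|]; apply: FRT => //.
- by move=> M [].
- by move=> M [].
- by move=> X M; apply: TF_retract.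
- by move=> X M; apply: TF_retract.
- by move=> M; apply: coind_TF.
- by move=> M; apply: res_TF.
- by move=> M [].
- by move=> M [].
- move=> X M XM [fgM GM]; split; first exact: retract_fin_gen fgM.
  exact: gorenstein_projective_retract GM.
- move=> X M XM [fgM GM]; split; first exact: retract_fin_gen fgM.
  exact: gorenstein_projective_retract GM.
- move=> M [fgM GM]; split; first exact: coind_fin_gen.
  exact: coind_gorenstein_projective.
move=> M [fgM GM]; split; first exact: res_fin_gen.
exact: res_gorenstein_projective.
Qed.
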